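(* For every $\kappa>1$ there exists a constant $C_\kappa>0$, depending only on $\kappa$, such that the following holds for every integer $n\ge 1$. Let $X=(X_1,\dots,X_n)$ be an unconditional, isotropic random vector in $\mathbb{R}^n$ with density $e^{-u(x)}$, where $u:\mathbb{R}^n\to\mathbb{R}\cup\{+\infty\}$ is such that the function $(x_1,\dots,x_n)\mapsto u(x_1^{\kappa},\dots,x_n^{\kappa})$ is convex on $\mathbb{R}^n_+=\{x\in\mathbb{R}^n:\ x_i\ge 0 \text{ for all } i\}$. Let $G$ be a standard Gaussian random variable and let $\theta=(\theta_1,\dots,\theta_n)\in S^{n-1}$. Then for every $t\in\mathbb{R}$, $$\left|\mathbb{P}(\theta\cdot X\ge t)-\mathbb{P}(G\ge t)\right|\le C_\kappa\sum_{k=1}^n|\theta_k|^3 .$$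
   Context: $S^{n-1}$ is the Euclidean unit sphere of $\mathbb{R}^n$ centered at $0$. A random vector $X=(X_1,\dots,X_n)$ is isotropic if $\mathbb{E}X_i=0$ and $\mathbb{E}X_iX_j=\delta_{i,j}$ for all $i,j$. It is unconditional if $(\varepsilon_1X_1,\dots,\varepsilon_nX_n)$ has the same distribution as $X$ for every choice of signs $\varepsilon_i=\pm1$. The value $u=+\infty$ is allowed, with $e^{-\infty}=0$. *)

(* Defs.v *)
From HB Require Import structures.
From mathcomp Require Import all_boot all_order all_algebra.
From mathcomp Require Import all_classical all_reals all_analysis.
From mathcomp Require Import measurable_realfun.

Set Implicit Arguments.
Unset Strict Implicit.
Unset Printing Implicit Defensive.

Import Order.TTheory GRing.Theory Num.Theory.
Import numFieldNormedType.Exports.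

Local Open Scope classical_set_scope.
Local Open Scope ring_scope.

(* A point of R^n is an [n.-tuple R]; the library equips this type with the
   product sigma-algebra, i.e. the Borel sigma-algebra of R^n. *)

Section lebesgue_tuple.
Context {R : realType}.

(* [measurableTypeR R] is [R], with the same measurable sets, as the domain of
   [lebesgue_measure]. *)
Definition cons_pair n (p : measurableTypeR R * n.-tuple R) : n.+1.-tuple R :=
  [tuple of p.1 :: p.2].

Lemma measurable_cons_pair n : measurable_fun setT (@cons_pair n).
Proof. exact: measurable_cons. Qed.

Section cons.
Variables (n : nat) (m : {sigma_finite_measure set (n.-tuple R) -> \bar R}).

Definition lebesgue_cons : set (n.+1.-tuple R) -> \bar R :=
  pushforward (lebesgue_measure \x m)%E (@cons_pair n).

HB.instance Definition _ := Measure.copy lebesgue_cons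
  (measure_function_pushforward__canonical__measure_function_Measure
     (lebesgue_measure \x m)%E (@measurable_cons_pair n)).

Let sigma_finite_lebesgue_cons : sigma_finite setT lebesgue_cons.
Proof.
have /sigma_finiteP[F [FT ndF Foo]] := sigma_finiteT (@lebesgue_measure R).
have /sigma_finiteP[G [GT ndG Goo]] := sigma_finiteT m.
pose g (x : n.+1.-tuple R) : measurableTypeR R * n.-tuple R :=
  (thead x, [tuple of behead x]).
have gK : cancel (@cons_pair n) g.
  move=> [a x]; rewrite /g /cons_pair /= theadE; congr pair.
  exact: val_inj.
have mg : measurable_fun setT g.
  apply/measurable_fun_pair; last exact: measurable_behead.
  exact: (@measurable_tnth _ R).
exists (fun i => g @^-1` (F i `*` G i)).
  apply/esym; rewrite -preimage_bigcup -subTset => x _ /=.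
  have [i _ Fi] : (\bigcup_i F i) (g x).1 by rewrite -FT.
  have [j _ Gj] : (\bigcup_j G j) (g x).2 by rewrite -GT.
  exists (maxn i j) => //; split.
    by move: Fi; exact/subsetPset/ndF/leq_maxl.
  by move: Gj; exact/subsetPset/ndG/leq_maxr.
move=> i; have [mF Fi] := Foo i; have [mG Gi] := Goo i; split.
  by rewrite -[X in measurable X]setTI; apply: mg => //; exact: measurableX.
rewrite /lebesgue_cons /pushforward -comp_preimage.
rewrite (_ : g \o _ = id); last by apply/funext => p /=; rewrite gK.
by rewrite preimage_id product_measure1E// lte_mul_pinfty// ge0_fin_numE.
Qed.

HB.instance Definition _ := @Measure_isSigmaFinite.Build _ _ _ lebesgue_cons
  sigma_finite_lebesgue_cons.
End cons.

Section nil.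
Definition lebesgue_nil : set (0.-tuple R) -> \bar R := dirac [tuple].
HB.instance Definition _ := Measure.on lebesgue_nil.
Let sigma_finite_lebesgue_nil : sigma_finite setT lebesgue_nil.
Proof.
apply: fin_num_fun_sigma_finite => [|A mA]; first by rewrite measure0.
by rewrite /lebesgue_nil diracE.
Qed.
HB.instance Definition _ := @Measure_isSigmaFinite.Build _ _ _ lebesgue_nil
  sigma_finite_lebesgue_nil.
End nil.

(* Lebesgue measure on R^n: the n-fold product of [lebesgue_measure]. *)
Fixpoint lebesgue_tuple n : {sigma_finite_measure set (n.-tuple R) -> \bar R} :=
  if n is n'.+1 then lebesgue_cons (lebesgue_tuple n') else lebesgue_nil.

Lemma lebesgue_tupleE n (A : 'I_n -> set R) : (forall i, measurable (A i)) ->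
  lebesgue_tuple n [set x | forall i, A i (tnth x i)] =
  (\prod_(i < n) lebesgue_measure (A i))%E.
Proof.
elim: n A => [|n IH] A mA.
  rewrite big_ord0 /= /lebesgue_nil diracE mem_set//=.
  by case.
rewrite big_ord_recl -IH; last by move=> i; exact: mA.
rewrite /= /lebesgue_cons /pushforward.
rewrite -product_measure1E; [|exact: mA|].
  congr product_measure1; apply/seteqP; split => -[a x] /=.
    move=> h; split; first exact: (h ord0).
    by move=> i; have := h (lift ord0 i); rewrite tnthS.
  move=> [ha hx] i; case: (unliftP ord0 i) => [j ->|->//].
  by rewrite tnthS.
rewrite (_ : mkset _ = \bigcap_(i in [set: 'I_n])
  ((fun x : n.-tuple R => tnth x i) @^-1` A (lift ord0 i))).
  apply: fin_bigcap_measurable => // i _.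
  rewrite -[X in measurable X]setTI.
  by apply: (@measurable_tnth _ R n i) => //; exact: mA.
by apply/seteqP; split => x /= h i; [move=> _; exact: h|exact: (h i)].
Qed.

End lebesgue_tuple.

Section euclidean_space.
Context {R : realType} {n : nat}.
Implicit Types x y : n.-tuple R.

Definition dot x y : R := \sum_(i < n) tnth x i * tnth y i.

Definition unit_sphere : set (n.-tuple R) := [set x | Num.sqrt (dot x x) = 1].

Definition orthant : set (n.-tuple R) := [set x | forall i, 0 <= tnth x i].

(* Only used on [orthant], where `^ is the usual real power (and 0 `^ k = 0 for
   k != 0). *)
Definition coord_pow (k : R) x : n.-tuple R := [tuple tnth x i `^ k | i < n].

Definition sign_flip (e : 'I_n -> bool) x : n.-tuple R :=
  [tuple (-1) ^+ e i * tnth x i | i < n].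

Definition segment_point (t : R) x y : n.-tuple R :=
  [tuple (1 - t) * tnth x i + t * tnth y i | i < n].

(* Convexity of a function that does not take the value -oo; the library's
   convention 0 * +oo = 0 makes the cases t = 0 and t = 1 trivial. *)
Definition econvex_on (D : set (n.-tuple R)) (f : n.-tuple R -> \bar R) : Prop :=
  forall x y (t : R), D x -> D y -> 0 <= t <= 1 ->
    (f (segment_point t x y) <= (1 - t)%:E * f x + t%:E * f y)%E.

End euclidean_space.

Section random_vector.
Context {R : realType} {n : nat} {d : measure_display} {T : measurableType d}.
Variables (P : probability T R) (X : {RV P >-> n.-tuple R}).

Definition coordinate (i : 'I_n) : T -> R := fun w => tnth (X w) i.

(* The second moments being finite, all these expectations are integrals of
   integrable functions. *)
Definition isotropic : Prop :=
  (forall i, 'E_P[coordinate i] = 0)%E /\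
  (forall i j, 'E_P[coordinate i \* coordinate j] = ((i == j)%:R)%:E)%E.

Definition unconditional : Prop :=
  forall (e : 'I_n -> bool) (A : set (n.-tuple R)), measurable A ->
    P ((sign_flip e \o X) @^-1` A) = distribution P X A.

(* The density [f] is only required to be Lebesgue measurable, i.e. almost
   everywhere equal to a Borel function [g]. *)
Definition has_density (f : n.-tuple R -> \bar R) : Prop :=
  exists g : n.-tuple R -> \bar R,
    [/\ measurable_fun setT g,
        {ae lebesgue_tuple n, forall x, f x = g x} &
        forall A, measurable A ->
          distribution P X A = (\int[lebesgue_tuple n]_(x in A) g x)%E].

End random_vector.

Definition standard_gaussian {R : realType} {d : measure_display}
    {T : measurableType d} (P : probability T R) (G : {RV P >-> R}) : Prop :=
  forall A : set R, measurable A -> distribution P G A = normal_prob 0 1 A.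

(* Main.v *)
(* On the positive orthant substitute x_i = p_i^kappa.  The density of p is then
   log-concave times prod p_i^(kappa - 1), and the midpoint z of p and q satisfies
   p q / z^2 = 1 - r^2 with r = (p - q) / (p + q).  So the Prekopa-Leindler
   inequality holds with the extra gain prod (1 - r_i^2)^(kappa - 1).  Applied to
   the triple (x_i^4, 1, 4^kappa x_i^2) it bounds E X_i^4.  Put
   Y = sum theta_i^2 X_i^2; applied to (1 + Y, 1 / (1 + Y), 1 + const * sum theta_i^4 X_i^4)
   it bounds E (Y - 1)^2 / (1 + Y), which is 4 E 1 / (1 + Y) - 2 because E Y = 1.

   Conditionally on |X_1|, ..., |X_n|, theta . X is a Rademacher sum of variance Y,
   so Stein's method gives a Berry-Esseen bound to P(sqrt Y G >= t).  Expanding the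
   latter at Y = 1, the linear term has mean zero and the remainder is
   O((Y - 1)^2 / (1 + Y)). *)

(* The law of [X] need not be log-concave and its coordinates may be dependent, so no variance bound
   for [Y] is at hand. What the midpoint inequality controls is the gap in Jensen's inequality for
   [1 / (1 + Y)]. The gain is at most [exp (- (kappa - 1) * sum r_i^2)], while [x_i^2 - y_i^2] is at
   most a constant times [|r_i| * z_i^2]; AM-GM therefore pays for the change of [Y] between two
   points with the gain and a multiple of [sum theta_i^4 z_i^4]. This trade is the source of the
   division by [kappa - 1] in the constant. The weight [(Y - 1)^2 / (1 + Y)] is quadratic near 1 and
   linear at infinity. The Gaussian expansion minus its linear term behaves in the same way, so this
   weak control of [Y] is enough. The density is known only up to a null set, and the midpoint of
   two good points may fall into that set. Giving the third function the value [+oo] there restores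
   the pointwise hypothesis at no cost in the integral. *)
From HB Require Import structures.
Require Import Defs.
From mathcomp Require Import all_boot all_order all_algebra.
From mathcomp Require Import all_classical all_reals all_analysis.
From mathcomp Require Import measurable_realfun.
From mathcomp Require Import ring lra.
Set Implicit Arguments.
Unset Strict Implicit.
Unset Printing Implicit Defensive.
Import Order.TTheory GRing.Theory Num.Theory.
Import numFieldNormedType.Exports.
Local Open Scope classical_set_scope.
Local Open Scope ring_scope.

(** * The Gaussian distribution function *)

Section gaussian_cdf.
Context {R : realType}.
Implicit Types x y t w : R.
Notation mu := (@lebesgue_measure R).
Notation phi := (normal_pdf (0 : R) 1).

Definition gcdf x : R := fine (normal_prob 0 1 `]-oo, x]).

Let one_neq0 : (1 : R) != 0. Proof. exact: oner_neq0. Qed.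

Lemma normal_probE A : measurable A ->
  normal_prob 0 1 A = (fine (normal_prob (0 : R) 1 A))%:E.
Proof. by move=> mA; rewrite fineK// fin_num_measure. Qed.

Lemma gcdf_ge0 x : 0 <= gcdf x.
Proof. exact: fine_ge0. Qed.

Lemma gcdf_le1 x : gcdf x <= 1.
Proof. by rewrite -lee_fin -normal_probE//; exact: probability_le1. Qed.

Lemma gcdf_le x y : x <= y -> gcdf x <= gcdf y.
Proof.
move=> xy; rewrite -lee_fin -!normal_probE//; apply: le_measure; rewrite ?inE//.
by move=> z /=; rewrite !in_itv/= => /le_trans; exact.
Qed.

(** The normal law has no atom at [t], so the closed half-line may be replaced by the open one,
    which is the complement of []-oo, t]]. *)
Lemma normal_prob_itv t : normal_prob 0 1 `[t, +oo[ = (1 - gcdf t)%:E.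
Proof.
have mphi D : measurable_fun D (EFin \o phi).
  by apply/measurable_funTS/measurable_EFinP; exact: measurable_normal_pdf.
rewrite /normal_prob -integral_itv_obnd_cbnd//.
rewrite -[LHS]/(normal_prob 0 1 `]t, +oo[) EFinB -normal_probE//.
rewrite -setCitvl probability_setC//.
Qed.

Lemma gcdfN x : gcdf (- x) = 1 - gcdf x.
Proof.
apply: EFin_inj; rewrite -normal_prob_itv -normal_probE//.
rewrite /normal_prob (@ge0_integration_by_substitutionNy _ (normal_pdf 0 1)).
- apply: eq_integral => y _; rewrite /= /normal_pdf (negbTE one_neq0).
  by congr (_ * _)%:E; rewrite /normal_fun !subr0 sqrrN.
- by apply: continuous_subspaceT; exact: continuous_normal_pdf.
- by move=> y _; exact: normal_pdf_ge0.
Qed.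

Lemma is_derive_gcdf x : is_derive x 1 gcdf (phi x).
Proof.
have [] := @continuous_FTC1 R phi -oo%O x (x + 1).
- by rewrite ltrDl.
- by apply: (integrableS _ _ (subsetT _)) => //; exact: integrable_normal_pdf.
- by rewrite ltNyr.
- exact: continuous_normal_pdf.
by move=> dx; rewrite derive1E => dE; exact: (DeriveDef dx dE).
Qed.

(** Continuity from above along half-lines with empty intersection. It replaces the limit at minus
    infinity in [mills]. *)
Lemma gcdf_small e : 0 < e -> forall x, exists2 y, y <= x & gcdf y < e.
Proof.
move=> e0 x; pose F (n : nat) : set R := `]-oo, (x - n%:R)%R]%classic.
have F0 : \bigcap_n F n = set0.
  rewrite -subset0 => z /(_ (Num.bound `|x - z|) I).
  rewrite /F/= in_itv/= => /[!lerBrDl] h.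
  exfalso; have := archi_boundP (normr_ge0 (x - z)); have := ler_norm (x - z)=> h1 h2; lra.
have : normal_prob (0 : R) 1 (F n) @[n --> \oo] --> 0%E.
  rewrite -(measure0 (normal_prob (0 : R) 1)) -F0.
  apply: nonincreasing_cvg_mu => //=.
  + apply: (le_lt_trans (probability_le1 (normal_prob 0 1) _)); rewrite ?ltry//.
    exact: measurable_itv.
  + by move=> i; exact: measurable_itv.
  + by rewrite F0.
  + move=> m n mn; apply/subsetPset => z; rewrite /F/= !in_itv/= => /le_trans; apply.
    by rewrite lerB// ler_nat.
have -> : (fun n => normal_prob 0 1 (F n)) = (fun n => (gcdf (x - n%:R))%:E).
  by apply/funext => n; rewrite /gcdf -normal_probE.
move=> /fine_cvgP[_] /cvgr0Pnorm_lt /(_ e e0) [N _ /(_ N (leqnn N))] /=.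
move=> h; exists (x - N%:R); first by rewrite gerBl.
by apply: le_lt_trans h; rewrite ler_norm.
Qed.

Lemma normal_pdf_gt0 x : 0 < phi x.
Proof.
by rewrite /normal_pdf (negbTE one_neq0) mulr_gt0 ?normal_peak_gt0// expR_gt0.
Qed.

Lemma normal_pdf01E x : phi x = normal_peak 1 * expR (- (x ^+ 2 / 2)).
Proof.
rewrite /normal_pdf (negbTE one_neq0) /normal_fun subr0 expr1n.
by congr (_ * expR _); field.
Qed.

Lemma normal_pdfN x : phi (- x) = phi x.
Proof. by rewrite !normal_pdf01E sqrrN. Qed.

Lemma is_derive_normal_pdf x : is_derive x 1 phi (- x * phi x).
Proof.
have -> : phi = (fun x => normal_peak 1 * expR (- (x ^+ 2 / 2))).
  by apply/funext => z; exact: normal_pdf01E.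
apply: is_derive_eq; rewrite /GRing.scale /=; by field.
Qed.


Lemma is_derive_MVT (f df : R -> R) x y :
  (forall z : R, is_derive z (1 : R) f (df z)) -> x < y ->
  exists2 z, x < z < y & f y - f x = df z * (y - x).
Proof.
move=> fdf xy; have [z|z] := @MVT R f df x y xy (fun z _ => fdf z).
  by apply: derivable_within_continuous => t _; have [] := fdf t.
by rewrite in_itv/= => zxy ->; exists z.
Qed.

(** On the negative axis [h z = gcdf z + phi z / z] has derivative [- phi z / z ^+ 2], so it
    decreases. Since [h <= gcdf] there and [gcdf] is arbitrarily small far to the left, [h w] cannot
    be positive. *)
Lemma mills w : w < 0 -> - w * gcdf w <= phi w.
Proof.
move=> w0; pose h z := gcdf z + phi z / z.
have dh (z : R) : z < 0 -> is_derive z 1 h (- (phi z / z ^+ 2)).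
  move=> z0; have z_neq0 : z != 0 by rewrite lt_eqF.
  have := is_derive_gcdf z; have := is_derive_normal_pdf z => ? ?.
  have dV : is_derive z 1 (fun x => x^-1) (- z ^- 2 *: 1).
    exact: (@is_deriveV _ id).
  apply: is_derive_eq; rewrite /GRing.scale/=; field.
  by [].
have hle y : y <= w -> h w <= h y.
  rewrite le_eqVlt => /predU1P[->//|yw].
  have [|z|c] := @MVT R h (fun z => - (phi z / z ^+ 2)) y w yw.
  - by move=> z; rewrite in_itv/= => /andP[_ zw]; apply: dh; apply: lt_trans w0.
  - apply: derivable_within_continuous => t; rewrite in_itv/= => /andP[_ tw].
    by have [] := dh t (le_lt_trans tw w0).
  move=> _ hE; rewrite -subr_le0 hE mulr_le0_ge0 ?subr_ge0 ?(ltW yw)//.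
  by rewrite oppr_le0 divr_ge0 ?sqr_ge0 ?ltW ?normal_pdf_gt0.
suff : h w <= 0.
  rewrite /h => hw; have := normal_pdf_gt0 w => pw.
  suff : w * (gcdf w + phi w / w) >= 0.
    by rewrite mulrDr mulrCA divff ?lt_eqF// mulr1 mulNr addrC -lerBlDr sub0r.
  by rewrite mulr_le0// ltW.
rewrite leNgt; apply/negP => hw0.
have [y yw gy] := gcdf_small hw0 w.
have := hle y yw; rewrite leNgt => /negP; apply.
apply: le_lt_trans gy; rewrite gerDl.
by rewrite pmulr_rle0 ?normal_pdf_gt0// invr_le0 (le_trans yw)// ltW.
Qed.

Lemma normal_pdf_le_abs x y : `|x| <= `|y| -> phi y <= phi x.
Proof.
move=> xy; rewrite !normal_pdf01E ler_wpM2l ?normal_peak_ge0// ler_expR lerN2.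
by rewrite ler_wpM2r// -(real_normK (num_real x)) -(real_normK (num_real y)) lerXn2r ?nnegrE.
Qed.

(** Below -1 this is Mills' inequality; between -1 and 0 it follows from [gcdf w <= 1] and
    [phi 1 <= phi w]. *)
Lemma gcdf_le_pdf w : w <= 0 -> gcdf w <= (1 + (phi 1)^-1) * phi w.
Proof.
move=> w0; have p1 := normal_pdf_gt0 1; have pw := normal_pdf_gt0 w.
have iv : 0 < (phi 1)^-1 by rewrite invr_gt0.
have [w1|w1] := leP w (-1).
  have := mills (le_lt_trans w1 (ltrN10 _)); have := gcdf_ge0 w => g0 mw.
  have : gcdf w <= - w * gcdf w by rewrite ler_peMl// lerNr.
  move=> gw; rewrite mulrDl mul1r (le_trans (le_trans gw mw))// lerDl.
  by rewrite mulr_ge0 ?ltW.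
apply: (le_trans (gcdf_le1 w)).
have : phi 1 <= phi w.
  by apply: normal_pdf_le_abs; rewrite normr1 ler0_norm// lerNl ltW.
rewrite mulrDl mul1r => h; apply: (@le_trans _ _ ((phi 1)^-1 * phi w)).
  by rewrite ler_pdivlMl// mulr1.
by rewrite lerDr ltW.
Qed.

(** The expression is the upper bound of the Stein solution in [stein_le]: the first estimate bounds
    the solution, the second its product with [w], hence its derivative. It is invariant under
    [w |-> - w], which reduces everything to [w <= 0]. *)
Lemma gcdf_tails w :
  gcdf w * (1 - gcdf w) / phi w <= 1 + (phi 1)^-1 /\
  `|w| * (gcdf w * (1 - gcdf w) / phi w) <= 1.
Proof.
wlog w0 : w / w <= 0 => [hw|].
  have [/hw//|/ltW w0] := leP w 0.
  have := hw (- w); rewrite gcdfN normal_pdfN normrN oppr_le0 => /(_ w0).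
  by rewrite subKr [(1 - _) * _]mulrC.
have pw := normal_pdf_gt0 w; have g0 := gcdf_ge0 w; have g1 := gcdf_le1 w.
have gg : gcdf w * (1 - gcdf w) <= gcdf w by rewrite ler_piMr// gerBl.
split.
  by rewrite ler_pdivrMr// (le_trans gg)// gcdf_le_pdf.
rewrite mulrA ler_pdivrMr// mul1r ler0_norm//.
have [->|wn] := eqVneq w 0; first by rewrite oppr0 mul0r ltW// normal_pdf_gt0.
apply: le_trans (mills _); last by rewrite lt_neqAle wn.
by rewrite ler_wpM2l// oppr_ge0.
Qed.

End gaussian_cdf.

(** * The Stein equation for the indicator of a half-line *)

Section stein_solution.
Context {R : realType}.
Implicit Types x y t w z : R.
Notation phi := (normal_pdf (0 : R) 1).
Notation K := (1 + (phi 1)^-1).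

(** The bounded solution of the Stein equation. Both branches are smooth on the whole line; gluing
    them at [t] leaves a continuous function whose derivative jumps there. *)
Definition stein t w : R :=
  if w <= t then (1 - gcdf t) * (gcdf w / phi w)
  else gcdf t * ((1 - gcdf w) / phi w).

(* The Stein equation [f' w = w * f w + 1_(w <= t) - gcdf t]. *)
Definition dstein t w : R := w * stein t w + (w <= t)%R%:R - gcdf t.

Lemma stein_ge0 t w : 0 <= stein t w.
Proof.
have pw := normal_pdf_gt0 w; have := @gcdf_ge0 R; have := @gcdf_le1 R => h1 h0.
by rewrite /stein; case: ifP => _; rewrite mulr_ge0 ?divr_ge0 ?subr_ge0 ?(ltW pw).
Qed.

(** For fixed [w] the solution, as a function of [t], is largest at [t = w], by monotonicity of
    [gcdf] on either side. *)
Lemma stein_le t w : stein t w <= gcdf w * (1 - gcdf w) / phi w.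
Proof.
have pw := normal_pdf_gt0 w; have := @gcdf_ge0 R; have := @gcdf_le1 R => h1 h0.
rewrite /stein; case: (leP w t) => wt; rewrite mulrA ler_pM2r ?invr_gt0//.
  by rewrite mulrC ler_wpM2l// lerB// gcdf_le.
by rewrite ler_wpM2r ?subr_ge0// gcdf_le// ltW.
Qed.

Lemma stein_norm_le t w : `|stein t w| <= K.
Proof.
by rewrite ger0_norm ?stein_ge0// (le_trans (stein_le t w))//; case: (gcdf_tails w).
Qed.

Lemma dstein_norm_le t w : `|dstein t w| <= 2.
Proof.
have h1 : `|w * stein t w| <= 1.
  rewrite normrM (ger0_norm (stein_ge0 t w)); have [_] := gcdf_tails w.
  by apply: le_trans; rewrite ler_wpM2l// stein_le.
have h2 : `|(w <= t)%R%:R - gcdf t| <= 1.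
  have := gcdf_ge0 t; have := gcdf_le1 t; case: (w <= t) => /= ? ?.
    by rewrite ger0_norm; lra.
  by rewrite sub0r normrN ger0_norm; lra.
rewrite /dstein -addrA (le_trans (ler_normD _ _))//.
by rewrite (le_trans (lerD h1 h2))//; lra.
Qed.

Lemma is_derive_gcdf_div_pdf c z :
  is_derive z 1 (fun w => c * (gcdf w / phi w)) (z * (c * (gcdf z / phi z)) + c).
Proof.
have p0 : phi z != 0 by rewrite gt_eqF// normal_pdf_gt0.
have := is_derive_gcdf z; have := is_derive_normal_pdf z => ? ?.
have dV := @is_deriveV _ phi z _ 1 p0 (is_derive_normal_pdf z).
by apply: is_derive_eq; rewrite /GRing.scale/=; field.
Qed.

Lemma is_derive_ccdf_div_pdf c z :
  is_derive z 1 (fun w => c * ((1 - gcdf w) / phi w))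
    (z * (c * ((1 - gcdf z) / phi z)) - c).
Proof.
have p0 : phi z != 0 by rewrite gt_eqF// normal_pdf_gt0.
have := is_derive_gcdf z; have := is_derive_normal_pdf z => ? ?.
have dV := @is_deriveV _ phi z _ 1 p0 (is_derive_normal_pdf z).
by apply: is_derive_eq; rewrite /GRing.scale/=; field.
Qed.

(** The interval must not cross the kink at [t]; then one branch, smooth on all of [R], represents
    the solution at both endpoints and the ordinary mean value theorem applies to it. *)
Lemma stein_MVT t x y : x < y -> y <= t \/ t <= x ->
  exists2 z, x < z < y & stein t y - stein t x = dstein t z * (y - x).
Proof.
move=> xy [yt|tx].
  have [z zxy e] := is_derive_MVT (is_derive_gcdf_div_pdf (1 - gcdf t)) xy.
  have /andP[xz zy] := zxy; exists z => //.
  have zt : z <= t by apply: le_trans yt; exact: ltW.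
  by rewrite /dstein /stein yt (le_trans (ltW xy) yt) zt e -addrA.
have [z zxy e] := is_derive_MVT (is_derive_ccdf_div_pdf (gcdf t)) xy.
have /andP[xz zy] := zxy; exists z => //.
have steinE w : t <= w -> stein t w = gcdf t * ((1 - gcdf w) / phi w).
  rewrite /stein le_eqVlt => /predU1P[<-|tw]; first by rewrite lexx mulrCA mulrA.
  by rewrite leNgt tw.
have tz : t < z by apply: le_lt_trans xz.
by rewrite /dstein !steinE ?(ltW tz) ?(le_trans tx (ltW xy))// e leNgt tz addr0.
Qed.

Lemma stein_lip t x y : `|stein t y - stein t x| <= 2 * `|y - x|.
Proof.
have lip a b : a <= b -> b <= t \/ t <= a -> `|stein t b - stein t a| <= 2 * (b - a).
  rewrite le_eqVlt => /predU1P[->|ab abt]; first by rewrite !subrr normr0 mulr0.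
  have [z _ ->] := stein_MVT ab abt.
  rewrite normrM (gtr0_norm (_ : 0 < b - a)) ?subr_gt0//.
  by rewrite ler_wpM2r ?dstein_norm_le// subr_ge0 ltW.
wlog xy : x y / x <= y => [hw|].
  have [/hw//|/ltW/hw] := leP x y.
  by rewrite distrC [in X in X -> _](distrC x y).
rewrite (ger0_norm (_ : 0 <= y - x)) ?subr_ge0//.
have [yt|ty] := leP y t; first by apply: lip => //; left.
have [tx|xt] := leP t x; first by apply: lip => //; right.
have := lip _ _ (ltW ty) (or_intror (lexx _)); have := lip _ _ (ltW xt) (or_introl (lexx _)).
have := ler_normD (stein t y - stein t t) (stein t t - stein t x).
by rewrite addrA subrK; lra.
Qed.

(** A first-order Taylor bound. If [t] separates the two points, the Lipschitz bound and
    [dstein_norm_le] cost 2 each, and [t] is within [|w - w'|] of [w]; this term is later averaged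
    by [rsum_concentration]. Otherwise the mean value theorem reduces the error to an increment of
    [dstein]. *)
Lemma stein_local t w w' :
  `|stein t w - stein t w' - (w - w') * dstein t w| <=
  `|w - w'| ^+ 2 * (2 * `|w| + K) + 4 * `|w - w'| * (`|w - t| <= `|w - w'|)%R%:R.
Proof.
have K0 : 0 <= K by rewrite addr_ge0// invr_ge0 ltW// normal_pdf_gt0.
have A0 : 0 <= `|w - w'| ^+ 2 * (2 * `|w| + K) by rewrite mulr_ge0// addr_ge0// mulr_ge0.
have [sep|nsep] := boolP ((w <= t) == (w' <= t)); last first.
  have -> : `|w - t| <= `|w - w'|.
    move: nsep; case: (leP w t) => wt; case: (leP w' t) => wt' //= _.
      by rewrite !ler0_norm ?subr_le0 ?(le_trans wt (ltW wt'))// lerN2 lerB// ltW.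
    by rewrite !ger0_norm ?subr_ge0 ?(le_trans wt' (ltW wt)) ?(ltW wt)// lerB.
  rewrite mulr1 (le_trans (ler_normB _ _))// (le_trans _ (ler_wpDl A0 (lexx _)))//.
  have := stein_lip t w' w; have : `|(w - w') * dstein t w| <= 2 * `|w - w'|.
    by rewrite normrM mulrC ler_wpM2r// dstein_norm_le.
  by lra.
apply: (@le_trans _ _ (`|w - w'| ^+ 2 * (2 * `|w| + K))); last first.
  by rewrite lerDl !mulr_ge0.
have [->|ww'] := eqVneq w' w; first by rewrite !subrr mul0r subrr normr0 expr0n mul0r.
have [z hz e] : exists2 z, `|z - w| <= `|w - w'| /\ (z <= t) = (w <= t) &
    stein t w - stein t w' = (w - w') * dstein t z.
  move: ww'; rewrite neq_lt => /orP[] ww'.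
    have [|z /andP[z1 z2] ->] := @stein_MVT t _ _ ww'.
      by move/eqP: sep; case: leP => h1 => [_|/esym/negbT]; [left|rewrite -ltNge => /ltW; right].
    exists z; last by rewrite mulrC.
    split; first by rewrite ler0_norm ?subr_le0 ?(ltW z2)// ger0_norm ?subr_ge0 ?(ltW ww')//; lra.
    move/eqP : sep; case: (leP w t) => h1 => [h2|/esym/negbT].
      by rewrite (le_trans (ltW z2)).
    by rewrite -ltNge => h; rewrite leNgt (lt_trans h).
  have [|z /andP[z1 z2] e] := @stein_MVT t _ _ ww'.
    by move/eqP: sep; case: leP => h1 => [/esym ?|_]; [left|right; exact: ltW].
  exists z; last by rewrite -[LHS]opprB e mulrC -mulNr opprB.
  split; first by rewrite ger0_norm ?subr_ge0 ?(ltW z1)// ler0_norm ?subr_le0 ?(ltW ww')//; lra.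
  move/eqP : sep; case: (leP w t) => h1 => [/esym h2|h2].
    by rewrite (le_trans (ltW z2)).
  by rewrite leNgt (lt_trans h1 z1).
rewrite e -mulrBr normrM expr2 -mulrA ler_wpM2l//.
(* [z] and [w] lie on the same side of [t], so the indicators in the Stein equation cancel. *)
have -> : dstein t z - dstein t w = (z - w) * stein t z + w * (stein t z - stein t w).
  by rewrite /dstein hz.2; ring.
have [h _] := hz.
rewrite (le_trans (ler_normD _ _))// !normrM.
have h1 : `|z - w| * `|stein t z| <= `|w - w'| * K.
  by rewrite ler_pM// stein_norm_le.
have h2 : `|w| * `|stein t z - stein t w| <= `|w| * (2 * `|w - w'|).
  by rewrite ler_wpM2l// (le_trans (stein_lip t w z))// ler_wpM2l.
by lra.
Qed.

End stein_solution.

(** * Stein's method for Rademacher sums *)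

Section rademacher.
Context {R : realType} {n : nat}.
Implicit Types (a : 'I_n -> R) (e : {ffun 'I_n -> bool}).
Implicit Types (F G : {ffun 'I_n -> bool} -> R).

Definition avg F : R := (\sum_e F e) / 2 ^+ n.

Definition rsum a e : R := \sum_(i < n) (-1) ^+ e i * a i.

Definition flip (i : 'I_n) e : {ffun 'I_n -> bool} := [ffun j => e j (+) (j == i)].

Lemma flipK i : involutive (flip i).
Proof. by move=> e; apply/ffunP => j; rewrite !ffunE addbK. Qed.

Lemma avg_flip i F : avg (fun e => F (flip i e)) = avg F.
Proof.
by rewrite /avg [in RHS](reindex_inj (inv_inj (flipK i))).
Qed.

Lemma eq_avg F G : F =1 G -> avg F = avg G.
Proof. by move=> FG; congr (_ / _); apply: eq_bigr. Qed.

Lemma avgD F G : avg (fun e => F e + G e) = avg F + avg G.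
Proof. by rewrite /avg big_split mulrDl. Qed.

Lemma avgZ c F : avg (fun e => c * F e) = c * avg F.
Proof. by rewrite /avg -mulr_sumr mulrA. Qed.

Lemma avgB F G : avg (fun e => F e - G e) = avg F - avg G.
Proof. by rewrite -mulN1r -avgZ -avgD; apply: eq_avg => e; rewrite mulN1r. Qed.

Lemma avg_sum (F : 'I_n -> {ffun 'I_n -> bool} -> R) :
  avg (fun e => \sum_i F i e) = \sum_i avg (F i).
Proof. by rewrite /avg exchange_big /= mulr_suml. Qed.

Lemma avg_le F G : (forall e, F e <= G e) -> avg F <= avg G.
Proof. by move=> FG; rewrite ler_wpM2r ?invr_ge0 ?exprn_ge0// ler_sum. Qed.

Lemma avg_cst c : avg (fun=> c) = c.
Proof.
rewrite /avg sumr_const card_ffun card_bool card_ord -[c *+ _]mulr_natr natrX.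
by rewrite mulfK// expf_neq0// pnatr_eq0.
Qed.

Lemma avg_norm F : `|avg F| <= avg (fun e => `|F e|).
Proof.
rewrite ler_norml; apply/andP; split; last by apply: avg_le => e; exact: ler_norm.
rewrite lerNl -mulN1r -avgZ; apply: avg_le => e.
by rewrite mulN1r -normrN ler_norm.
Qed.

Lemma rsum_flip a i e : rsum a (flip i e) = rsum a e - 2 * ((-1) ^+ e i * a i).
Proof.
rewrite /rsum (bigD1 i)//= [in RHS](bigD1 i)//= ffunE eqxx.
rewrite (eq_bigr (fun j => (-1) ^+ e j * a j)); last first.
  by move=> j ji; rewrite ffunE (negbTE ji) addbF.
by case: (e i); rewrite /= ?expr0 ?expr1; ring.
Qed.

Lemma flip_at i e : flip i e i = ~~ e i.
Proof. by rewrite ffunE eqxx addbT. Qed.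

(* Discrete integration by parts. *)
Lemma avg_rsumM a F :
  avg (fun e => rsum a e * F e) =
  \sum_i avg (fun e => (-1) ^+ e i * a i / 2 * (F e - F (flip i e))).
Proof.
rewrite /rsum (eq_avg (G := fun e => \sum_i ((-1) ^+ e i * a i * F e))); last first.
  by move=> e; rewrite mulr_suml.
rewrite avg_sum; apply: eq_bigr => i _.
have : avg (fun e => (-1) ^+ e i * a i * F e) =
    avg (fun e => - ((-1) ^+ e i * a i) * F (flip i e)).
  rewrite -[LHS](avg_flip i); apply: eq_avg => e; rewrite flip_at.
  by case: (e i); rewrite /= ?expr0 ?expr1; ring.
move=> h; have -> : avg (fun e => (-1) ^+ e i * a i / 2 * (F e - F (flip i e))) =
    2^-1 * avg (fun e => (-1) ^+ e i * a i * F e) +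
    2^-1 * avg (fun e => - ((-1) ^+ e i * a i) * F (flip i e)).
  by rewrite -!avgZ -avgD; apply: eq_avg => e; ring.
by rewrite -h; field.
Qed.

Lemma sqr_sign_mul a i e : ((-1) ^+ e i * a i) ^+ 2 = a i ^+ 2.
Proof. by rewrite exprMn sqrr_sign mul1r. Qed.

Lemma norm_sign_mul a i e : `|(-1) ^+ e i * a i| = `|a i|.
Proof. by rewrite normrM normr_sign mul1r. Qed.

(** Integration by parts with [F = rsum a]: flipping sign [i] changes the sum by twice its [i]-th
    term, so that only [a i ^+ 2] remains. *)
Lemma avg_rsum_sqr a : avg (fun e => rsum a e ^+ 2) = \sum_i a i ^+ 2.
Proof.
rewrite (eq_avg (G := fun e => rsum a e * rsum a e)) => [|e]; last by rewrite expr2.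
rewrite avg_rsumM; apply: eq_bigr => i _; rewrite -[RHS]avg_cst; apply: eq_avg => e.
by rewrite rsum_flip -[in RHS](sqr_sign_mul a i e); field.
Qed.

Lemma avg_norm_rsum a : \sum_i a i ^+ 2 = 1 -> avg (fun e => `|rsum a e|) <= 1.
Proof.
move=> a1; have : avg (fun e => 1 + rsum a e ^+ 2) = 2 by rewrite avgD avg_cst avg_rsum_sqr a1.
have : avg (fun e => 2 * `|rsum a e|) <= avg (fun e => 1 + rsum a e ^+ 2).
  apply: avg_le => e; rewrite -(real_normK (num_real (rsum a e))).
  by rewrite -subr_ge0; have := sqr_ge0 (1 - `|rsum a e|); rewrite sqrrB; lra.
by rewrite avgZ => ? ?; lra.
Qed.

Definition clip (L w : R) : R := Num.max (- L) (Num.min L w).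

Lemma clip_norm_le L w : 0 <= L -> `|clip L w| <= L.
Proof.
move=> L0; rewrite /clip ler_norml le_max lexx /= ge_max ge_min lexx /= andbT.
by lra.
Qed.

Lemma clip_le L v w : v <= w -> clip L v <= clip L w.
Proof.
move=> vw; rewrite /clip ge_max !le_max lexx/=; apply/orP; right.
by rewrite le_min !ge_min lexx vw orbT.
Qed.

(** Since [v] stays at distance [d] from both clipping levels, moving it by [2 * s] changes the
    clipped value by at least [min d (2 * |s|)]. This is at least [2 * |s| - s ^+ 2 / d], because
    [(d - |s|) ^+ 2 >= 0]. *)
Lemma clip_diff L d v s : 0 < d -> `|v| <= L - d ->
  s ^+ 2 - `|s| ^+ 3 / (2 * d) <= s / 2 * (clip L v - clip L (v - 2 * s)).
Proof.
move=> d0; rewrite ler_norml => /andP[v1 v2].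
have key u : 0 <= u ->
    2 * u - u ^+ 2 / d <= Num.min d (2 * u).
  move=> u0; rewrite le_min; apply/andP; split.
    rewrite -subr_ge0; have -> : d - (2 * u - u ^+ 2 / d) = (d - u) ^+ 2 / d.
      by field; rewrite gt_eqF.
    by rewrite divr_ge0 ?sqr_ge0 ?ltW.
  by rewrite gerBl divr_ge0 ?sqr_ge0 ?ltW.
have cv : clip L v = v.
  by rewrite /clip min_r ?max_r//; lra.
have half u : 0 <= u -> u ^+ 2 - u ^+ 3 / (2 * d) = u / 2 * (2 * u - u ^+ 2 / d).
  by move=> u0; field; rewrite gt_eqF.
have [s0|/ltW s0] := leP 0 s.
  rewrite ger0_norm// half// ler_wpM2l ?divr_ge0//.
  apply: le_trans (key s s0) _; rewrite cv /clip.
  rewrite [Num.min L _]min_r; last by lra.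
  have [h|h] := leP (- L) (v - 2 * s).
    by rewrite ge_min; apply/orP; right; lra.
  by rewrite ge_min; apply/orP; left; lra.
have Ns0 : 0 <= - s by rewrite oppr_ge0.
rewrite (ler0_norm s0) -[s ^+ 2]sqrrN half// -[leRHS]mulrNN -[X in _ <= X * _]mulNr.
rewrite ler_wpM2l ?divr_ge0//.
apply: le_trans (key _ Ns0) _; rewrite cv opprB /clip.
rewrite [Num.max _ _]max_r; last by rewrite le_min; apply/andP; split; lra.
have [h|h] := leP L (v - 2 * s).
  by rewrite ge_min; apply/orP; left; lra.
by rewrite ge_min; apply/orP; right; lra.
Qed.

(** Test the integration by parts formula with the identity clipped around the midpoint [m] of the
    interval. The average of [W * f W] is at most [L]. From below, on the event the terms sum to at
    least [1 - b / (2 * b) = 1 / 2], and off the event they are nonnegative because [clip] is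
    monotone. *)
Lemma rsum_concentration a (x y : R) : \sum_i a i ^+ 2 = 1 -> x <= y ->
  avg (fun e => (x <= rsum a e <= y)%R%:R) <= y - x + 2 * \sum_i `|a i| ^+ 3.
Proof.
move=> a1 xy; set b := \sum_i _.
have b0 : 0 < b.
  rewrite lt_neqAle sumr_ge0 ?andbT => [|i _]; last by rewrite exprn_ge0.
  apply/negP => /eqP/esym/eqP; rewrite psumr_eq0 => [/allP a0|i _]; last by rewrite exprn_ge0.
  have : (1 : R) = 0.
    rewrite -a1; apply: big1 => i _; have := a0 i (mem_index_enum i).
    by rewrite expf_eq0/= normr_eq0 => /eqP ->; rewrite expr0n.
  by move/eqP; rewrite oner_eq0.
(* The clipping level exceeds the half-length of the interval by [b]; this margin is the [d] of
   [clip_diff], and it makes the cubic loss exactly one half. *)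
pose L := (y - x) / 2 + b; pose m := (x + y) / 2.
have L0 : 0 <= L by rewrite /L; lra.
pose f w := clip L (w - m).
have up : avg (fun e => rsum a e * f (rsum a e)) <= L.
  apply: (@le_trans _ _ (avg (fun e => L * `|rsum a e|))).
    apply: avg_le => e; rewrite (le_trans (ler_norm _))// normrM mulrC.
    by rewrite ler_wpM2r// clip_norm_le.
  by rewrite avgZ ler_piMr// avg_norm_rsum.
have low : avg (fun e => (x <= rsum a e <= y)%R%:R) / 2 <=
    avg (fun e => rsum a e * f (rsum a e)).
  rewrite avg_rsumM.
  have -> : avg (fun e => (x <= rsum a e <= y)%R%:R) / 2 =
      \sum_i avg (fun e => (a i ^+ 2 - `|a i| ^+ 3 / (2 * b)) * (x <= rsum a e <= y)%R%:R).
    rewrite (eq_bigr _ (fun i _ => avgZ _ _)) -mulr_suml mulrC; congr (_ * _).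
    rewrite big_split/= a1 sumrN -mulr_suml -/b; field.
    by rewrite gt_eqF.
  apply: ler_sum => i _; apply: avg_le => e; rewrite rsum_flip.
  have [/andP[h1 h2]|_] := boolP (x <= rsum a e <= y).
    rewrite mulr1 -(sqr_sign_mul a i e) -(norm_sign_mul a i e) /f.
    have -> : rsum a e - 2 * ((-1) ^+ e i * a i) - m = (rsum a e - m) - 2 * ((-1) ^+ e i * a i).
      by ring.
    by apply: clip_diff => //; rewrite ler_norml /m /L; lra.
  rewrite mulr0 /f; set s := _ * a i.
  have [s0|/ltW s0] := leP 0 s.
    by rewrite mulr_ge0 ?divr_ge0// subr_ge0 clip_le//; lra.
  by rewrite mulr_le0// ?subr_le0 ?clip_le//; lra.
by have := le_trans low up; rewrite /L; lra.
Qed.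

(** Average the Stein equation at [W], using [sum a_i^2 = 1] to distribute [g W] over the
    coordinates. Integration by parts then leaves one Taylor error per coordinate, of step
    [2 * |a i|], bounded by [stein_local]. *)
Lemma rsum_berry_esseen_le a (t : R) : \sum_i a i ^+ 2 = 1 ->
  `|avg (fun e => (rsum a e <= t)%R%:R) - gcdf t| <=
  (30 + 2 * (normal_pdf (0 : R) 1 1)^-1) * \sum_i `|a i| ^+ 3.
Proof.
move=> a1; set b := \sum_i `|a i| ^+ 3; set p := _^-1.
have p0 : 0 <= p by rewrite invr_ge0 ltW// normal_pdf_gt0.
pose f := stein t; pose g := dstein t; pose W := rsum a.
have -> : avg (fun e => (W e <= t)%R%:R) - gcdf t =
    \sum_i avg (fun e => a i ^+ 2 * g (W e) -
       (-1) ^+ e i * a i / 2 * (f (W e) - f (W (flip i e)))).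
  rewrite -[X in _ - X]avg_cst -avgB.
  rewrite (eq_bigr _ (fun i _ => avgB _ _)) big_split/= sumrN -(avg_rsumM a (f \o W)).
  rewrite (eq_bigr _ (fun i _ => avgZ _ _)) -mulr_suml a1 mul1r -avgB.
  by apply: eq_avg => e; rewrite /g /dstein /f /W /=; ring.
apply: (le_trans (ler_norm_sum _ _ _)).
(* With the average of [|W|] at most 1 and the concentration bound [4 * |a i| + 2 * b], the [i]-th
   error is at most [2 * (3 + p) * |a i| ^+ 3 + 4 * a i ^+ 2 * (4 * |a i| + 2 * b)]. *)
apply: (@le_trans _ _ (\sum_i ((22 + 2 * p) * `|a i| ^+ 3 + a i ^+ 2 * (8 * b)))); last first.
  by rewrite big_split/= -mulr_sumr -mulr_suml a1 -/b; lra.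
apply: ler_sum => i _.
apply: (le_trans (avg_norm _)).
apply: (@le_trans _ _ (avg (fun e => 2 * `|a i| ^+ 3 * (2 * `|W e| + (1 + p)) +
    4 * `|a i| ^+ 2 * (t - 2 * `|a i| <= W e <= t + 2 * `|a i|)%R%:R))).
  apply: avg_le => e; set s := (-1) ^+ e i * a i.
  have := stein_local t (W e) (W (flip i e)); rewrite /W rsum_flip -/s -/(W e).
  have -> : W e - (W e - 2 * s) = 2 * s by ring.
  have -> : `|2 * s| = 2 * `|a i| by rewrite normrM norm_sign_mul ger0_norm.
  have -> : (`|W e - t| <= 2 * `|a i|) = (t - 2 * `|a i| <= W e <= t + 2 * `|a i|).
    by rewrite ler_distl.
  rewrite -/p => h.
  have -> : a i ^+ 2 * g (W e) - s / 2 * (f (W e) - f (W e - 2 * s)) =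
    - (s / 2 * (f (W e) - f (W e - 2 * s) - 2 * s * g (W e))).
    by rewrite -(sqr_sign_mul a i e) -/s; field.
  rewrite normrN normrM.
  have -> : `|s / 2| = `|a i| / 2 by rewrite normrM norm_sign_mul ger0_norm.
  rewrite mulrAC ler_pdivrMr//.
  have := ler_wpM2l (normr_ge0 (a i)) h.
  rewrite /f /g; lra.
rewrite avgD !avgZ avgD avgZ avg_cst.
have h1 := avg_norm_rsum a1.
have h2 : avg (fun e => (t - 2 * `|a i| <= W e <= t + 2 * `|a i|)%R%:R) <= 4 * `|a i| + 2 * b.
  apply: le_trans (rsum_concentration a1 _) _; last by rewrite -/b; lra.
  by have := normr_ge0 (a i); lra.
have := ler_wpM2l (sqr_ge0 (a i)) h2.
have := ler_wpM2l (exprn_ge0 3 (normr_ge0 (a i))) h1.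
have -> : a i ^+ 2 = `|a i| ^+ 2 by rewrite real_normK ?num_real.
lra.
Qed.

End rademacher.

(** * Gaussian expansion of the tail of a Rademacher sum around variance 1 *)

Section sign_average.
Context {R : realType}.
Implicit Types x y t s z : R.
Notation phi := (normal_pdf (0 : R) 1).
Notation peak := (normal_peak (1 : R)).

Let peak_ge0 : 0 <= peak. Proof. exact: normal_peak_ge0. Qed.

Lemma is_derive_MVT_between (f df : R -> R) x y :
  (forall z : R, is_derive z (1 : R) f (df z)) ->
  exists2 z, `|z - x| <= `|y - x| /\ Num.min x y <= z & f y - f x = df z * (y - x).
Proof.
move=> fdf; have [xy|yx|->] := ltgtP x y.
- have [z /andP[xz zy] e] := is_derive_MVT fdf xy; exists z => //.
  rewrite (ltW xz); split=> //.
  by rewrite !ger0_norm ?subr_ge0 ?lerB ?(ltW zy) ?(ltW xz) ?(ltW xy).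
- have [z /andP[yz zx] e] := is_derive_MVT fdf yx; exists z.
    rewrite (ltW yz); split=> //.
    by rewrite !ler0_norm ?subr_le0 ?(ltW zx) ?(ltW yx)//; lra.
  by rewrite -opprB e -mulrN opprB.
- by exists y; [split|rewrite !subrr mulr0].
Qed.

Lemma abs_mul_normal_pdf_le x : `|x| * phi x <= peak.
Proof.
rewrite normal_pdf01E mulrCA ler_piMr// expRN ler_pdivrMr ?expR_gt0// mul1r.
apply: le_trans (expR_ge1Dx _); rewrite -(real_normK (num_real x)).
by have := sqr_ge0 (`|x| - 1); rewrite sqrrB; lra.
Qed.

Lemma cube_mul_normal_pdf_le x : `|x| ^+ 3 * phi x <= 16 * peak.
Proof.
rewrite normal_pdf01E mulrCA [leRHS]mulrC ler_wpM2l// expRN ler_pdivrMr ?expR_gt0//.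
(* Splitting the exponential into two equal factors yields the quartic lower bound
   [(1 + u ^+ 2 / 4) ^+ 2], which dominates [u ^+ 3 / 16]. *)
have -> : x ^+ 2 / 2 = x ^+ 2 / 4 + x ^+ 2 / 4 by field.
rewrite expRD -(real_normK (num_real x)); set u := `|x|.
have e1 := expR_ge1Dx (u ^+ 2 / 4).
have u0 : 0 <= u by exact: normr_ge0.
have : (1 + u ^+ 2 / 4) * (1 + u ^+ 2 / 4) <= expR (u ^+ 2 / 4) * expR (u ^+ 2 / 4).
  by rewrite ler_pM// addr_ge0// divr_ge0 ?sqr_ge0.
have : 0 <= (u - 4 / 3) ^+ 2 * u ^+ 2 by rewrite mulr_ge0 ?sqr_ge0.
have := sqr_ge0 u.
have := sqr_ge0 (u ^+ 2 - u); nra.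
Qed.

(** Uniformity in [t] comes from the second derivative in the scale: at [v] it is
    [- (t * v) ^+ 3 * phi (t * v) / v ^+ 2], bounded by [16 * peak / v ^+ 2], and [v >= 1 / 2]. Two
    applications of the mean value theorem produce this second-order term. *)
Lemma gcdf_scale_taylor t s : 2^-1 <= s ->
  `|gcdf (t * s) - gcdf t - t * phi t * (s - 1)| <= 64 * peak * (s - 1) ^+ 2.
Proof.
move=> s2.
have d1 z : is_derive z 1 (fun z => gcdf (t * z) - t * phi t * z)
    (t * phi (t * z) - t * phi t).
  have dt : is_derive z 1 ( *%R t) t by apply: is_derive_eq; rewrite /GRing.scale/=; ring.
  have := @is_derive1_comp _ (@gcdf R) ( *%R t) z _ _ (is_derive_gcdf (t * z)) dt.
  rewrite /comp => d; apply: is_derive_eq; rewrite /GRing.scale/=; ring.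
have d2 z : is_derive z 1 (fun z => t * phi (t * z))
    (- (t * (t * z) * t * phi (t * z))).
  have dt : is_derive z 1 ( *%R t) t by apply: is_derive_eq; rewrite /GRing.scale/=; ring.
  have := @is_derive1_comp _ phi ( *%R t) z _ _ (is_derive_normal_pdf (t * z)) dt.
  rewrite /comp => d; apply: is_derive_eq; rewrite /GRing.scale/=; ring.
have [z [zs mz] ez] := is_derive_MVT_between 1 s d1.
have [v [vz mv] ev] := is_derive_MVT_between 1 z d2.
have -> : gcdf (t * s) - gcdf t - t * phi t * (s - 1) =
    - (t * (t * v) * t * phi (t * v)) * (z - 1) * (s - 1).
  by rewrite -ev /= mulr1 -ez mulr1; ring.
have v2 : 2^-1 <= v.
  move: mv mz; rewrite !ge_min => /orP[|]; first by lra.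
  by move=> zv /orP[|]; lra.
have v0 : 0 < v by lra.
rewrite !normrM normrN.
apply: (@le_trans _ _ (64 * peak * `|z - 1| * `|s - 1|)); last first.
  rewrite -(real_normK (num_real (s - 1))) expr2 mulrA.
  by rewrite ler_wpM2r// ler_wpM2l ?mulr_ge0.
rewrite ler_wpM2r// ler_wpM2r//.
have -> : t * (t * v) * t * phi (t * v) = ((t * v) ^+ 3 * phi (t * v)) / v ^+ 2.
  by field; rewrite gt_eqF.
rewrite normrM normfV (ger0_norm (sqr_ge0 v)) ler_pdivrMr ?exprn_gt0//.
rewrite normrM normrX (ger0_norm (ltW (normal_pdf_gt0 _))).
apply: (le_trans (cube_mul_normal_pdf_le _)).
have : 2^-1 * 2^-1 <= v * v by rewrite ler_pM.
by move=> /(ler_wpM2l peak_ge0); lra.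
Qed.

Notation KBE := (30 + 2 * (normal_pdf (0 : R) 1 1)^-1).

(** Negating both the coefficients and the threshold turns the lower tail into the upper one while
    keeping the weak inequality. *)
Lemma rsum_berry_esseen n (a : 'I_n -> R) t : \sum_i a i ^+ 2 = 1 ->
  `|avg (fun e => (t <= rsum a e)%R%:R) - (1 - gcdf t)| <= KBE * \sum_i `|a i| ^+ 3.
Proof.
move=> a1; have := @rsum_berry_esseen_le R n (fun i => - a i) (- t).
rewrite gcdfN.
under eq_bigr do rewrite sqrrN; move=> /(_ a1).
under [X in _ <= _ * X -> _]eq_bigr do rewrite normrN.
rewrite (eq_avg (G := fun e => (t <= rsum a e)%R%:R))// => e.
rewrite /rsum; under eq_bigr do rewrite mulrN.
by rewrite sumrN lerN2.
Qed.

(* The correction [t * phi t / 2 * (Y - 1)] has mean zero when [E Y = 1]. *)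
Lemma rsum_gaussian_approx : exists2 C : R, 0 <= C &
  forall n (a : 'I_n -> R) t Y, Y = \sum_i a i ^+ 2 ->
  `|avg (fun e => (t <= rsum a e)%R%:R) - (1 - gcdf t) - t * phi t / 2 * (Y - 1)|
   <= C * (\sum_i `|a i| ^+ 3 + (Y - 1) ^+ 2 / (1 + Y)).
Proof.
have K0 : 0 <= KBE by rewrite addr_ge0// mulr_ge0// invr_ge0 ltW// normal_pdf_gt0.
(* [8] bounds the cubed normalization [s ^+ 3], [36] compares [(s - 1) ^+ 2] with [D], [74] is
   [64 + 10] from the Taylor and linearization errors, and [4] serves the range where [Y] is far
   from 1. *)
exists (8 * KBE + 36 * (74 * peak) + 4).
  by rewrite !addr_ge0// !mulr_ge0.
move=> n a t Y YE.
have Y0 : 0 <= Y by rewrite YE; apply: sumr_ge0 => i _; exact: sqr_ge0.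
set b := \sum_i `|a i| ^+ 3.
have b0 : 0 <= b by apply: sumr_ge0 => i _; rewrite exprn_ge0.
set D := _ / (1 + Y).
have D0 : 0 <= D by rewrite divr_ge0 ?sqr_ge0 ?addr_ge0.
have tp : `|t * phi t| <= peak.
  by rewrite normrM [X in _ * X]ger0_norm ?abs_mul_normal_pdf_le// ltW ?normal_pdf_gt0.
set A := avg _; set g := 1 - gcdf t.
have A01 : 0 <= A <= 1.
  apply/andP; split.
    by rewrite -(avg_cst (n := n) (0 : R)); apply: avg_le => e.
  by rewrite -[leRHS](avg_cst (n := n) (1 : R)); apply: avg_le => e; case: (t <= _)%R.
have Ag : `|A - g| <= 1.
  have /andP[? ?] := A01; have := gcdf_ge0 t; have := gcdf_le1 t.
  by rewrite /g ler_norml; lra.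
have [Yin|Yout] := boolP (4^-1 <= Y <= 4); last first.
  have D1 : 1 + `|Y - 1| <= 4 * D.
    rewrite /D mulrA ler_pdivlMr; last by lra.
    move: Yout; rewrite negb_and -!ltNge => /orP[h|h].
      by rewrite ler0_norm; [nra|lra].
    by rewrite ger0_norm; [nra|lra].
  apply: (le_trans (ler_normB _ _)); rewrite normrM [`|t * phi t / 2|]normrM.
  rewrite [X in _ * X * _]ger0_norm//.
  have h1 : `|t * phi t| / 2 * `|Y - 1| <= peak * `|Y - 1|.
    by rewrite ler_wpM2r// ler_pdivrMr// (le_trans tp)// ler_peMr// ler1n.
  have := normr_ge0 (Y - 1); have := mulr_ge0 K0 b0; have := mulr_ge0 K0 D0.
  have := mulr_ge0 peak_ge0 b0; have := mulr_ge0 peak_ge0 D0.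
  have := ler_wpM2l peak_ge0 D1.
  nra.
have /andP[Y1 Y4] := Yin.
(* Scaling by [s] gives the sum unit variance and moves the threshold to [t * s]. *)
pose s := (Num.sqrt Y)^-1.
have Ypos : 0 < Y by lra.
have s0 : 0 < s by rewrite invr_gt0 sqrtr_gt0.
have sY : Y = s ^- 2 by rewrite /s exprVn sqr_sqrtr// invrK.
have s2Y : s ^+ 2 * Y = 1 by rewrite sY divff// expf_neq0// gt_eqF.
have s12 : 2^-1 <= s.
  rewrite leNgt; apply/negP => h.
  have : s * s < 2^-1 * 2^-1 by rewrite ltr_pM// ltW.
  nra.
have s2 : s <= 2.
  rewrite leNgt; apply/negP => h.
  have : 2 * 2 < s * s by rewrite ltr_pM.
  nra.
have be : `|A - (1 - gcdf (t * s))| <= KBE * (8 * b).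
  have -> : A = avg (fun e => (t * s <= rsum (fun i => s * a i) e)%R%:R).
    apply: eq_avg => e; congr (nat_of_bool _)%:R.
    have -> : rsum (fun i => s * a i) e = rsum a e * s.
      by rewrite /rsum mulr_suml; apply: eq_bigr => i _; ring.
    by rewrite ler_pM2r.
  apply: (le_trans (rsum_berry_esseen _ _)).
    by under eq_bigr do rewrite exprMn; rewrite -mulr_sumr -YE.
  rewrite ler_wpM2l//; under eq_bigr do rewrite normrM exprMn.
  rewrite -mulr_sumr ler_wpM2r// ger0_norm ?(ltW s0)//.
  have : s ^+ 3 <= 2 ^+ 3 by rewrite lerXn2r// nnegrE ltW.
  by lra.
have ty := gcdf_scale_taylor t s12.
have sD : (s - 1) ^+ 2 <= 36 * D.
  rewrite /D mulrA ler_pdivlMr; last by lra.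
  have -> : Y - 1 = (1 - s) * ((1 + s) / s ^+ 2).
    by rewrite sY; field; rewrite gt_eqF.
  rewrite exprMn -[(s - 1) ^+ 2]sqrrN opprB mulrCA ler_wpM2l ?sqr_ge0//.
  have : 3 / 8 <= (1 + s) / s ^+ 2.
    rewrite ler_pdivlMr ?exprn_gt0//; nra.
  nra.
(* Since [Y = s ^- 2], the linear terms in [s] and in [Y] cancel to first order:
   [(s - 1) + (Y - 1) / 2] has the factor [(s - 1) ^+ 2]. *)
have lin : `|t * phi t * (s - 1) + t * phi t / 2 * (Y - 1)| <= 10 * peak * (s - 1) ^+ 2.
  have -> : t * phi t * (s - 1) + t * phi t / 2 * (Y - 1) =
      t * phi t * ((s - 1) ^+ 2 * ((1 + 2 * s) / (2 * s ^+ 2))).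
    by rewrite sY; field; rewrite gt_eqF.
  have -> : 10 * peak * (s - 1) ^+ 2 = peak * ((s - 1) ^+ 2 * 10) by ring.
  rewrite [X in X <= _]normrM ler_pM//.
  have q0 : 0 < 2 * s ^+ 2 by rewrite mulr_gt0// exprn_gt0.
  rewrite normrM ger0_norm ?sqr_ge0// ler_wpM2l ?sqr_ge0// ger0_norm; last first.
    by rewrite divr_ge0 ?(ltW q0)//; lra.
  by rewrite ler_pdivrMr//; nra.
have -> : A - g - t * phi t / 2 * (Y - 1) = (A - (1 - gcdf (t * s))) -
    (gcdf (t * s) - gcdf t - t * phi t * (s - 1)) -
    (t * phi t * (s - 1) + t * phi t / 2 * (Y - 1)).
  by rewrite /g; ring.
apply: (le_trans (ler_normB _ _)); apply: (le_trans (lerD (ler_normB _ _) (lexx _))).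
have := ler_wpM2l peak_ge0 sD.
have := mulr_ge0 K0 b0; have := mulr_ge0 K0 D0.
have := mulr_ge0 peak_ge0 b0; have := mulr_ge0 peak_ge0 D0.
lra.
Qed.

End sign_average.

(** * The Prekopa-Leindler inequality *)

Section brunn_minkowski_line.
Context {R : realType}.
Notation mu := (@lebesgue_measure R).
Implicit Types A B C : set (measurableTypeR R).

Let measurable_affine (b : R) :
  measurable_fun setT (fun z : measurableTypeR R => 2 * z - b : measurableTypeR R).
Proof. by apply: measurable_funB => //; apply: measurable_funM. Qed.

Lemma measurable_midpoint_preimage b A :
  measurable A -> measurable [set z : measurableTypeR R | A (2 * z - b)].
Proof. by move=> mA; rewrite -[X in measurable X]setTI; exact: measurable_affine. Qed.

(** Twice the pushforward by [z |-> 2 * z - b] agrees with Lebesgue measure on half-open intervals,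
    hence everywhere. *)
Lemma lebesgue_measure_midpoint b A : measurable A ->
  mu [set z | A (2 * z - b)] = ((2^-1)%:E * mu A)%E.
Proof.
move=> mA; pose mixin := isMeasurableFun.Build _ _ _ _ _ (measurable_affine b).
pose psi : {mfun _ >-> _} :=
  HB.pack (fun z : measurableTypeR R => 2 * z - b : measurableTypeR R) mixin.
rewrite [in RHS](@lebesgue_measure_unique _ (mscale 2%:nng (pushforward mu psi))) //.
  by rewrite /mscale/= /pushforward muleA -EFinM mulVf ?mul1e.
move=> _ [[x y]] /= _ <-; rewrite /mscale /=.
have -> : pushforward mu
      (fun z : measurableTypeR R => 2 * z - b : measurableTypeR R) `]x, y]%classic =
    mu `](x + b) / 2, (y + b) / 2]%classic.
  congr (mu _).
  by apply/seteqP; split => z /=; rewrite !in_itv/= => /andP[? ?]; apply/andP; split; lra.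
rewrite !lebesgue_measure_itv/= !lte_fin ltr_pM2r// ltrD2r.
case: ifP => _; last by rewrite mule0.
by rewrite -!EFinD -EFinM; congr EFin; field.
Qed.

(** [C] contains the half-size copies [(A + b) / 2] and [(a + B) / 2]. With [a] close to the
    supremum of [A] and [b] close to the infimum of [B], the first lies essentially to the left of
    the second. *)
Lemma brunn_minkowski_line A B C : measurable A -> measurable B -> measurable C ->
  has_sup A -> has_inf B -> (forall x y, A x -> B y -> C ((x + y) / 2)) ->
  ((2^-1)%:E * mu A + (2^-1)%:E * mu B <= mu C)%E.
Proof.
move=> mA mB mC supA infB ABC; apply/lee_addgt0Pr => e e0.
have [a Aa ae] := sup_adherent e0 supA.
have [b Bb be] := inf_adherent e0 infB.
pose U := [set z : measurableTypeR R | A (2 * z - b)].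
pose V := [set z : measurableTypeR R | B (2 * z - a)].
have mU : measurable U by exact: measurable_midpoint_preimage.
have mV : measurable V by exact: measurable_midpoint_preimage.
have UC : U `<=` C.
  by move=> z /ABC /(_ Bb); rewrite subrK mulrC mulrA mulVf// mul1r.
have VC : V `<=` C.
  by move=> z /(ABC _ _ Aa); rewrite addrC subrK mulrC mulrA mulVf// mul1r.
rewrite -(lebesgue_measure_midpoint b mA) -(lebesgue_measure_midpoint a mB) -/U -/V.
(* The overlap lies in an interval of length [((sup A - a) + (b - inf B)) / 2], and each difference
   is less than [e]. *)
have UV : (mu (U `&` V) <= e%:E)%E.
  apply: (@le_trans _ _ (mu `[(a + inf B) / 2, (sup A + b) / 2]%classic)).
    apply: le_measure; rewrite ?inE; [exact: measurableI|exact: measurable_itv|].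
    move=> z [/= Uz Vz]; rewrite /= in_itv/=.
    have := ub_le_sup supA.2 Uz; have := ge_inf infB.2 Vz.
    by move=> ? ?; apply/andP; split; lra.
  rewrite lebesgue_measure_itv/= lte_fin; case: ifP => _; last by rewrite lee_fin ltW.
  by rewrite -EFinB lee_fin; lra.
rewrite (measureDI mu mU mV).
rewrite addeAC leeD// -measureU//; [|exact: measurableD|]; last first.
  by apply/seteqP; split => // z [[_ ?] ?].
apply: le_measure; rewrite ?inE//; first by apply: measurableU => //; exact: measurableD.
by move=> z [[/UC]|/VC].
Qed.

End brunn_minkowski_line.

(** * The one-dimensional Prekopa-Leindler inequality *)

Section prekopa_leindler_line.
Context {R : realType}.
Notation mu := (@lebesgue_measure R).
Notation T := (measurableTypeR R).
Local Open Scope ereal_scope.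
Implicit Types f g h : T -> \bar R.
Notation I01 := (`]0%R, 1%R[%classic : set T).

Let layer_set f : set (T * T) := [set p | (0 < p.2 < 1)%R /\ p.2%:E < f p.1].

Let measurable_layer_set f : measurable_fun setT f -> measurable (layer_set f).
Proof.
move=> mf; rewrite (_ : layer_set f = (setT `*` `]0%R, 1%R[%classic) `&`
    [set p | p.2%:E < f p.1]); last first.
  by apply/seteqP; split => p /=; rewrite in_itv/= => -[] //= []// _.
apply: measurableI; first exact: measurableX.
rewrite -[X in measurable X]setTI; apply: measurable_lte => //.
  by apply/measurable_EFinP; exact: measurable_snd.
exact: measurableT_comp mf (@measurable_fst _ _ _ _).
Qed.

Let layer_ysection f l : (0 < l < 1)%R -> ysection (layer_set f) l = [set x | l%:E < f x].
Proof.
by move=> l01; apply/seteqP; split => x; rewrite /ysection /= inE /layer_set/= => -[].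
Qed.

Lemma measurable_superlevel f l : measurable_fun setT f -> measurable [set x | l%:E < f x].
Proof. by move=> mf; rewrite -[X in measurable X]setTI; exact: measurable_lte. Qed.

Lemma measurable_fun_superlevel f : measurable_fun setT f ->
  measurable_fun I01 (fun l : T => mu [set x | l%:E < f x]).
Proof.
move=> mf; apply: (@eq_measurable_fun _ _ _ _ _ (fun l => mu (ysection (layer_set f) l))).
  by move=> l; rewrite inE/= in_itv/= => /layer_ysection ->.
by apply/measurable_funTS/measurable_fun_ysection; exact: measurable_layer_set.
Qed.

(** Tonelli on the part of the subgraph with heights in []0, 1[]. Stopping at height 1 loses nothing
    for functions bounded by 1, and for [h] it only lowers the integral, which is the useful
    direction. *)
Lemma layer_cake01 f : measurable_fun setT f ->
  \int[mu]_(l in I01) mu [set x | l%:E < f x] =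
  \int[mu]_x mu (I01 `&` [set l : T | l%:E < f x]).
Proof.
move=> mf; have mS := measurable_layer_set mf.
pose F (p : T * T) := (\1_(layer_set f) p)%:E : \bar R.
have mF : measurable_fun setT F by apply/measurable_EFinP/measurable_indic.
transitivity (\int[mu]_l \int[mu]_x F (x, l)).
  rewrite [LHS]integral_mkcond; apply: eq_integral => l _; rewrite patchE.
  case: ifPn => [|]; rewrite mem_setE in_itv/= => l01.
    rewrite -layer_ysection// -[ysection _ _]setIT -integral_indic//; last first.
      exact: measurable_ysection.
    by apply: eq_integral => x _; rewrite /F !indicE mem_ysection.
  rewrite integral0_eq// => x _; rewrite /F indicE memNset// /layer_set/= => -[l01'].
  by rewrite l01' in l01.
rewrite -(fubini_tonelli F)//; last by move=> p; rewrite lee_fin.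
apply: eq_integral => x _; rewrite (_ : _ `&` _ = xsection (layer_set f) x); last first.
  by apply/seteqP; split => l; rewrite /xsection/= inE /layer_set/= in_itv.
rewrite -[xsection _ _]setIT -integral_indic//; last exact: measurable_xsection.
by apply: eq_integral => l _; rewrite /F !indicE mem_xsection.
Qed.

Let level_oc (r : R) : (0 <= r)%R -> mu (`]0%R, r[%classic : set T) = r%:E.
Proof.
move=> r0; rewrite lebesgue_measure_itv/= lte_fin; case: ltP => [_|r0'].
  by rewrite -EFinB subr0.
by congr EFin; apply/eqP; rewrite eq_le r0 r0'.
Qed.

Lemma layer_cake01_le f : measurable_fun setT f -> (forall x, 0 <= f x) ->
  \int[mu]_(l in I01) mu [set x | l%:E < f x] <= \int[mu]_x f x.
Proof.
move=> mf f0; rewrite layer_cake01//; apply: ge0_le_integral => //.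
  apply: (@eq_measurable_fun _ _ _ _ _ (fun x => mu (xsection (layer_set f) x))).
    move=> x _; congr (mu _); apply/seteqP.
    by split => l; rewrite /xsection/= inE /layer_set/= in_itv.
  by apply/measurable_fun_xsection; exact: measurable_layer_set.
move=> x _; move: (f0 x); case: (f x) => [r|_|]; [|by rewrite leey|by rewrite leeNy_eq].
rewrite lee_fin => r0; rewrite -[leRHS](level_oc r0); apply: le_measure.
- rewrite inE; apply: measurableI; first exact: measurable_itv.
  by rewrite -[X in measurable X]setTI; apply: measurable_lte.
- by rewrite inE; exact: measurable_itv.
- by move=> l [/=]; rewrite !in_itv/= lte_fin => /andP[-> _].
Qed.

Lemma layer_cake01_eq f : measurable_fun setT f -> (forall x, 0 <= f x <= 1) ->
  \int[mu]_(l in I01) mu [set x | l%:E < f x] = \int[mu]_x f x.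
Proof.
move=> mf f01; rewrite layer_cake01//; apply: eq_integral => x _.
move: (f01 x); case: (f x) => [r| |]; last 2 first.
  by rewrite leye_eq andbF.
  by rewrite leeNy_eq.
rewrite !lee_fin => /andP[r0 r1]; rewrite -[RHS](level_oc r0); congr (mu _).
apply/seteqP; split => l; rewrite /= !in_itv/= lte_fin.
  by move=> [/andP[-> _] ->].
by move=> /andP[-> lr]; split => //; rewrite (lt_le_trans lr).
Qed.

(* Brunn-Minkowski needs nonempty level sets, hence the two supremum hypotheses. *)
Let prekopa_leindler_normalized (f g : T -> R) h (k : R) :
  measurable_fun setT f -> measurable_fun setT g -> measurable_fun setT h ->
  (forall x, 0 <= f x <= 1)%R -> (forall x, 0 <= g x <= 1)%R -> (forall x, 0 <= h x) ->
  (forall l, l < 1 -> exists x, l < f x)%R -> (forall l, l < 1 -> exists x, l < g x)%R ->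
  (forall x, 0 < f x -> `|x| <= k)%R -> (forall x, 0 < g x -> `|x| <= k)%R ->
  (forall x y, (f x * g y)%:E <= h ((x + y) / 2)%R * h ((x + y) / 2)%R) ->
  (2^-1)%:E * \int[mu]_x (f x)%:E + (2^-1)%:E * \int[mu]_x (g x)%:E <= \int[mu]_x h x.
Proof.
move=> mf mg mh f01 g01 h0 fs gs fk gk fgh.
have mEf : measurable_fun setT (EFin \o f) by exact/measurable_EFinP.
have mEg : measurable_fun setT (EFin \o g) by exact/measurable_EFinP.
rewrite -(@layer_cake01_eq (EFin \o f))// -(@layer_cake01_eq (EFin \o g))//.
rewrite -!ge0_integralZl//; try exact: measurable_fun_superlevel.
rewrite -ge0_integralD//; first last.
- by apply: measurable_funeM; exact: measurable_fun_superlevel.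
- by move=> *; rewrite mule_ge0.
- by apply: measurable_funeM; exact: measurable_fun_superlevel.
- by move=> *; rewrite mule_ge0.
apply: le_trans (layer_cake01_le mh h0); apply: ge0_le_integral => //.
- by move=> *; rewrite adde_ge0// mule_ge0.
- by apply: emeasurable_funD; apply: measurable_funeM; exact: measurable_fun_superlevel.
- exact: measurable_fun_superlevel.
move=> l /=; rewrite in_itv/= => /andP[l0 l1].
apply: brunn_minkowski_line; try exact: measurable_superlevel.
- split; first by have [x lx] := fs l l1; exists x; rewrite /= lte_fin.
  exists k => x /=; rewrite lte_fin => lx.
  by have := fk x (lt_trans l0 lx); rewrite ler_norml => /andP[].
- split; first by have [x lx] := gs l l1; exists x; rewrite /= lte_fin.
  exists (- k)%R => x /=; rewrite lte_fin => lx.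
  by have := gk x (lt_trans l0 lx); rewrite ler_norml => /andP[].
(* Levels are inherited by midpoints: [h <= l] at the midpoint would give
   [h ^+ 2 <= l ^+ 2 < f x * g y]. *)
move=> x y /=; rewrite !lte_fin => lf lg; rewrite ltNge; apply/negP => hl.
have := fgh x y; rewrite leNgt => /negP; apply.
apply: (@le_lt_trans _ _ (l%:E * l%:E)); first by rewrite lee_pmul.
by rewrite -EFinM lte_fin ltr_pM// ltW.
Qed.


(** Dividing by the supremum makes every level below 1 attained, as Brunn-Minkowski requires. A zero
    supremum means a zero integral, for which the inequality is trivial. *)
Let normalize (f : T -> R) (k : R) : measurable_fun setT f ->
  (forall x, 0 <= f x <= k)%R -> \int[mu]_x (f x)%:E = 0 \/
  exists2 a, (0 < a)%R & exists f1 : T -> R, [/\ measurable_fun setT f1,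
    (forall x, f x = a * f1 x)%R, (forall x, 0 <= f1 x <= 1)%R,
    (forall l, l < 1 -> exists x, l < f1 x)%R &
    \int[mu]_x (f x)%:E = a%:E * \int[mu]_x (f1 x)%:E].
Proof.
move=> mf fk; pose a := sup (range f).
have fS : has_sup (range f).
  by split; [exists (f point), point|exists k => _ [x _ <-]; case/andP: (fk x)].
have fa x : (f x <= a)%R by apply: ub_le_sup; [exact: fS.2|exists x].
have f0 x : (0 <= f x)%R by case/andP: (fk x).
have [a0|a0] := leP a 0%R.
  left; apply: integral0_eq => x _; congr EFin; apply/eqP.
  by rewrite eq_le f0 (le_trans (fa x)).
right; exists a => //; exists (fun x => a^-1 * f x)%R; split.
- exact: measurable_funM.
- by move=> x; rewrite mulrA divff ?mul1r// gt_eqF.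
- move=> x; rewrite mulr_ge0 ?invr_ge0 ?(ltW a0)//=.
  by rewrite ler_pdivrMl// mulr1.
- move=> l l1; have e0 : (0 < (1 - l) * a)%R by rewrite mulr_gt0// subr_gt0.
  have [_ [x _ <-]] := sup_adherent e0 fS.
  rewrite -/a => h; exists x; rewrite ltr_pdivlMl//; apply: le_lt_trans h.
  by rewrite mulrBl mul1r subKr mulrC.
- rewrite -ge0_integralZl_EFin//; last exact: ltW.
  + by apply: eq_integral => x _; rewrite -EFinM mulrA divff ?mul1r// gt_eqF.
  + by move=> x _; rewrite lee_fin mulr_ge0// invr_ge0 ltW.
  + by apply/measurable_EFinP; exact: measurable_funM.
Qed.

(** With [a], [b] the suprema, [f / a], [g / b] and [h / sqrt (a * b)] satisfy the normalized
    hypotheses. The resulting arithmetic-mean bound implies the product form, since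
    [4 * F * G <= (F + G) ^+ 2]. *)
Let prekopa_leindler_bounded (f g : T -> R) h (k : R) :
  measurable_fun setT f -> measurable_fun setT g -> measurable_fun setT h ->
  (forall x, 0 <= f x <= k)%R -> (forall x, 0 <= g x <= k)%R -> (forall x, 0 <= h x) ->
  (forall x, 0 < f x -> `|x| <= k)%R -> (forall x, 0 < g x -> `|x| <= k)%R ->
  (forall x y, (f x * g y)%:E <= h ((x + y) / 2)%R * h ((x + y) / 2)%R) ->
  \int[mu]_x (f x)%:E * \int[mu]_x (g x)%:E <= \int[mu]_x h x * \int[mu]_x h x.
Proof.
move=> mf mg mh f0k g0k h0 fk gk fgh.
have H0 : 0 <= \int[mu]_x h x by exact: integral_ge0.
have [->|[a a0 [f1 [mf1 ff1 f01 fs ->]]]] := normalize mf f0k.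
  by rewrite mul0e mule_ge0.
have [->|[b b0 [g1 [mg1 gg1 g01 gs ->]]]] := normalize mg g0k.
  by rewrite mule0 mule_ge0.
pose c := Num.sqrt (a * b).
have c0 : (0 < c)%R by rewrite sqrtr_gt0 mulr_gt0.
have cc : (c * c = a * b)%R by rewrite -expr2 sqr_sqrtr// mulr_ge0 ?ltW.
have mch : measurable_fun setT (fun x => c^-1%:E * h x) by exact: measurable_funeM.
have ch0 x : 0 <= c^-1%:E * h x by rewrite mule_ge0// lee_fin invr_ge0 ltW.
have f1k x : (0 < f1 x -> `|x| <= k)%R by move=> h'; apply: fk; rewrite ff1 mulr_gt0.
have g1k x : (0 < g1 x -> `|x| <= k)%R by move=> h'; apply: gk; rewrite gg1 mulr_gt0.
have fgh1 x y : (f1 x * g1 y)%:E <=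
    (c^-1%:E * h ((x + y) / 2)%R) * (c^-1%:E * h ((x + y) / 2)%R).
  rewrite muleACA -EFinM -invfM cc.
  have ab0 : (0 < (a * b)^-1)%R by rewrite invr_gt0 mulr_gt0.
  have := fgh x y; rewrite ff1 gg1 => hxy.
  have -> : (f1 x * g1 y)%:E = (a * b)^-1%:E * (a * f1 x * (b * g1 y))%:E.
    by rewrite -EFinM; congr EFin; field; rewrite !gt_eqF.
  by rewrite lee_pmul2l.
have := prekopa_leindler_normalized mf1 mg1 mch f01 g01 ch0 fs gs f1k g1k fgh1.
have -> : \int[mu]_x (c^-1%:E * h x) = c^-1%:E * \int[mu]_x h x.
  by rewrite ge0_integralZl_EFin// invr_ge0 ltW.
move: H0; case: (\int[mu]_x h x) => [H H0|_ _|]; last by rewrite leeNy_eq.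
  2: by rewrite mulyy leey.
have F0 : 0 <= \int[mu]_x (f1 x)%:E.
  by apply: integral_ge0 => x _; rewrite lee_fin; case/andP: (f01 x).
have G0 : 0 <= \int[mu]_x (g1 x)%:E.
  by apply: integral_ge0 => x _; rewrite lee_fin; case/andP: (g01 x).
move: F0 G0; case: (\int[mu]_x (f1 x)%:E) => [F|_ G0|]; last by rewrite leeNy_eq.
  2: by rewrite gt0_muley ?lte_fin// addye// -?ltNye ?(lt_le_trans _ (mule_ge0 _ G0))// leye_eq.
case: (\int[mu]_x (g1 x)%:E) => [G|_ G0|]; last by rewrite leeNy_eq.
  2: by rewrite gt0_muley ?lte_fin// addey// leye_eq.
rewrite -!EFinM -EFinD !lee_fin => F0 G0 FGH.
have {}FGH : (c * (F + G) <= 2 * H)%R.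
  have := ler_wpM2l (ltW c0) FGH; rewrite mulrA divff ?gt_eqF// mul1r; lra.
have -> : (a * F * (b * G) = c * c * (F * G))%R by rewrite cc; ring.
rewrite !lee_fin in H0.
have : ((c * (F + G)) * (c * (F + G)) <= (2 * H) * (2 * H))%R.
  by rewrite ler_pM// mulr_ge0 ?addr_ge0// ltW.
have : (0 <= c * c * ((F - G) * (F - G)))%R by rewrite -!expr2 mulr_ge0 ?sqr_ge0.
by nra.
Qed.

(** Cutting the height at [k] and the support to [[-k, k]] meets the hypotheses of the bounded case,
    and the cut functions increase to [f] with [k]. *)
Let trunc (k : nat) f (x : T) : R :=
  (fine (mine (f x) k%:R%:E) * \1_(`[- k%:R, k%:R]%classic : set T) x)%R.

Let truncE k f x : (0 <= f x) ->
  trunc k f x = if (`|x| <= k%:R)%R then fine (mine (f x) k%:R%:E) else 0%R.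
Proof.
move=> f0; rewrite /trunc indicE mem_setE in_itv/= -ler_norml.
by case: ifP; rewrite ?mulr1 ?mulr0.
Qed.

Let mine_fin k f x : 0 <= f x -> mine (f x) k%:R%:E \is a fin_num.
Proof.
move=> f0; rewrite ge0_fin_numE; last by rewrite le_min f0 lee_fin ler0n.
by rewrite gt_min ltry orbT.
Qed.

Let trunc_bound k f x : 0 <= f x -> (0 <= trunc k f x <= k%:R)%R.
Proof.
move=> f0; rewrite truncE//; case: ifP => _; last by rewrite lexx ler0n.
apply/andP; split; first by rewrite fine_ge0// le_min f0 lee_fin ler0n.
by rewrite -lee_fin fineK ?mine_fin// ge_min lexx orbT.
Qed.

Let trunc_le k f x : 0 <= f x -> (trunc k f x)%:E <= f x.
Proof.
move=> f0; rewrite truncE//; case: ifP => // _.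
by rewrite fineK ?mine_fin// ge_min lexx.
Qed.

Let trunc_cvg f x : 0 <= f x -> (trunc k f x)%:E @[k --> \oo] --> f x.
Proof.
move=> f0; have kx : \forall k \near \oo, (`|x| <= k%:R)%R by exact: nbhs_infty_ger.
case fx : (f x) f0 => [r| |] f0.
- apply: cvg_near_cst; near=> k.
  rewrite truncE ?fx// ifT; last by near: k.
  rewrite min_l//= lee_fin; near: k; exact: nbhs_infty_ger.
- apply: (@cvg_trans _ ((k%:R%:E : \bar R) @[k --> \oo])); last exact/cvgenyP/cvg_id.
  apply: near_eq_cvg; near=> k; rewrite truncE ?fx// ifT; last by near: k.
  by rewrite min_r// leey.
- by move: f0; rewrite leeNy_eq.
Unshelve. all: by end_near. Qed.

Let trunc_nd f x : 0 <= f x -> {homo (fun k => (trunc k f x)%:E) : n m / (n <= m)%N >-> n <= m}.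
Proof.
move=> f0 n m nm; rewrite lee_fin !truncE//.
have nm' : (n%:R <= m%:R :> R)%R by rewrite ler_nat.
case: ifP => [xn|_]; last by case/andP: (trunc_bound m f0); rewrite truncE.
rewrite (le_trans xn)// fine_le ?mine_fin// le_min ge_min lexx/= ge_min orbC.
by rewrite lee_fin nm'.
Qed.

Let measurable_trunc k f : measurable_fun setT f -> measurable_fun setT (trunc k f).
Proof.
move=> mf; apply: measurable_funM; last exact: measurable_indic.
by apply: measurableT_comp => //; exact: measurable_mine.
Qed.

Let trunc_integral f : measurable_fun setT f -> (forall x, 0 <= f x) ->
  \int[mu]_x (trunc k f x)%:E @[k --> \oo] --> \int[mu]_x f x.
Proof.
move=> mf f0; rewrite [X in _ --> X](_ : _ =
    \int[mu]_x limn (fun k => (trunc k f x)%:E)).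
  apply: cvg_monotone_convergence => //.
  - by move=> k; apply/measurable_EFinP; exact: measurable_trunc.
  - by move=> k x _; rewrite lee_fin; case/andP: (trunc_bound k (f0 x)).
  - by move=> x _; exact: trunc_nd.
by apply: eq_integral => x _; apply/esym/cvg_lim => //; exact: trunc_cvg.
Qed.

Theorem prekopa_leindler_line f g h :
  measurable_fun setT f -> measurable_fun setT g -> measurable_fun setT h ->
  (forall x, 0 <= f x) -> (forall x, 0 <= g x) -> (forall x, 0 <= h x) ->
  (forall x y, f x * g y <= h ((x + y) / 2)%R * h ((x + y) / 2)%R) ->
  \int[mu]_x f x * \int[mu]_x g x <= \int[mu]_x h x * \int[mu]_x h x.
Proof.
move=> mf mg mh f0 g0 h0 fgh.
have [F0|F0] := eqVneq (\int[mu]_x f x) 0.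
  by rewrite F0 mul0e mule_ge0// integral_ge0.
have [G0|G0] := eqVneq (\int[mu]_x g x) 0.
  by rewrite G0 mule0 mule_ge0// integral_ge0.
(* The limit of a product needs the product of the limits not to be of the form zero times infinity;
   the zero integrals were set aside for this. *)
have FG : (\int[mu]_x f x *? \int[mu]_x g x) by rewrite mule_defE (negbTE F0) (negbTE G0).
apply: (cvge_le _ (cvgeM FG (trunc_integral mf f0) (trunc_integral mg g0))).
apply: nearW => k; apply: (@prekopa_leindler_bounded _ _ _ k%:R) => //.
- exact: measurable_trunc.
- exact: measurable_trunc.
- by move=> x; exact: trunc_bound.
- by move=> x; exact: trunc_bound.
- by move=> x; rewrite truncE//; case: ifP => //; rewrite ltxx.
- by move=> x; rewrite truncE//; case: ifP => //; rewrite ltxx.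
move=> x y; apply: le_trans (fgh x y); rewrite EFinM.
have /andP[? _] := trunc_bound k (f0 x); have /andP[? _] := trunc_bound k (g0 y).
by apply: lee_pmul; rewrite ?lee_fin//; exact: trunc_le.
Qed.

End prekopa_leindler_line.

(** * Integration against a measure with a density *)

Section integral_density.
Context d (T : measurableType d) (R : realType).
Variables (mu nu : {measure set T -> \bar R}) (w : T -> R).
Hypothesis mw : measurable_fun setT w.
Hypothesis w0 : forall x, 0 <= w x.
Hypothesis nuE : forall A, measurable A -> nu A = (\int[mu]_(x in A) (w x)%:E)%E.
Local Open Scope ereal_scope.

Import HBNNSimple.

Let nnsfun_density (h : {nnsfun T >-> R}) :
  \int[nu]_x (h x)%:E = \int[mu]_x ((h x)%:E * (w x)%:E).
Proof.
have mh r : measurable (h @^-1` [set r]) by exact: measurable_funPTI.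
have mi r : measurable_fun setT (fun x => (r * \1_(h @^-1` [set r]) x)%:E).
  by apply/measurable_EFinP/measurable_funM => //; exact: measurable_indic.
transitivity (\sum_(r \in range h) \int[nu]_x (r * \1_(h @^-1` [set r]) x)%:E).
  rewrite -ge0_integral_fsum//; last by move=> r x _; exact: nnfun_muleindic_ge0.
  by apply: eq_integral => x _; rewrite fsumEFin// -fimfunE.
transitivity (\sum_(r \in range h)
    \int[mu]_x ((r * \1_(h @^-1` [set r]) x)%:E * (w x)%:E)); last first.
  rewrite -ge0_integral_fsum//.
  - apply: eq_integral => x _; rewrite [in RHS]fimfunE -fsumEFin//.
    rewrite ge0_mule_fsuml// => r; exact: nnfun_muleindic_ge0.
  - by move=> r; apply: emeasurable_funM => //; exact/measurable_EFinP.
  - by move=> r x _; rewrite mule_ge0 ?lee_fin// -lee_fin nnfun_muleindic_ge0.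
apply: eq_fsbigr => r; rewrite inE => -[z _ hz].
have r0 : (0 <= r)%R by rewrite -hz; exact: fun_ge0.
under eq_integral do rewrite EFinM.
rewrite ge0_integralZl_EFin//; last first.
  by apply/measurable_EFinP; exact: measurable_indic.
rewrite integral_indic// setIT nuE//.
rewrite [X in _ * X]integral_mkcond -ge0_integralZl_EFin//; last 2 first.
- by move=> x _; rewrite patchE; case: ifP => //; rewrite lee_fin.
- by apply/(measurable_restrictT _ _).1 => //; apply/measurable_funTS/measurable_EFinP.
apply: eq_integral => x _; rewrite EFinM -muleA; congr (_ * _).
by rewrite patchE indicE; case: ifP; rewrite ?mul1e ?mul0e.
Qed.

(** The formula is known on sets, extends to simple functions by linearity, and passes to increasing
    limits by monotone convergence on both sides. *)
Lemma ge0_integral_density (f : T -> \bar R) : measurable_fun setT f ->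
  (forall x, 0 <= f x) -> \int[nu]_x f x = \int[mu]_x (f x * (w x)%:E).
Proof.
move=> mf f0; pose h := nnsfun_approx measurableT mf.
have hf x : (h n x)%:E @[n --> \oo] --> f x by exact: cvg_nnsfun_approx.
have hnd x : {homo (fun n => (h n x)%:E) : n m / (n <= m)%N >-> n <= m}.
  by move=> n m nm; rewrite lee_fin; exact/lefP/nd_nnsfun_approx.
have -> : \int[nu]_x f x = limn (fun n => \int[nu]_x (h n x)%:E).
  rewrite -monotone_convergence//.
  - by apply: eq_integral => x _; apply/esym/cvg_lim.
  - by move=> n; exact/measurable_EFinP.
  - by move=> n x _; rewrite lee_fin fun_ge0.
have -> : \int[mu]_x (f x * (w x)%:E) = limn (fun n => \int[mu]_x ((h n x)%:E * (w x)%:E)).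
  rewrite -monotone_convergence//.
  - apply: eq_integral => x _; apply/esym/cvg_lim => //.
    exact: cvgeZr (hf x).
  - by move=> n; apply: emeasurable_funM; exact/measurable_EFinP.
  - by move=> n x _; rewrite mule_ge0 ?lee_fin// fun_ge0.
  - by move=> x _ n m nm; rewrite lee_wpmul2r ?lee_fin//; exact/lefP/nd_nnsfun_approx.
by under eq_fun do rewrite nnsfun_density.
Qed.

End integral_density.

Lemma density_measure_exists d (T : measurableType d) (R : realType)
    (mu : {measure set T -> \bar R}) (w : T -> R) :
  measurable_fun setT w -> (forall x, 0 <= w x) ->
  exists nu : {measure set T -> \bar R},
    forall A, nu A = (\int[mu]_(x in A) (w x)%:E)%E.
Proof.
move=> mw w0; pose m (A : set T) := (\int[mu]_(x in A) (w x)%:E)%E.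
have m0 : m set0 = 0%E by rewrite /m integral_set0.
have mge A : (0 <= m A)%E by apply: integral_ge0 => x _; rewrite lee_fin.
have msa : semi_sigma_additive m.
  move=> /= A mA tA mUA; rewrite /m ge0_integral_bigcup//.
  - by apply: is_cvg_ereal_nneg_natsum_cond => i _ _; exact: mge.
  - by apply/measurable_funTS/measurable_EFinP.
  - by move=> x _; rewrite lee_fin.
pose nu : {measure set T -> \bar R} := HB.pack m (isMeasure.Build _ _ _ m m0 mge msa).
by exists nu.
Qed.

(** * The power substitution *)

Section power_substitution.
Context {R : realType}.
Variable k : R.
Hypothesis k1 : 1 < k.
Notation mu := (@lebesgue_measure R).
Notation T := (measurableTypeR R).
Implicit Types p q x y : R.

Let k0 : 0 < k. Proof. exact: lt_trans k1. Qed.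

(* Extending by the identity makes [p |-> p `^ k] a bijection of the line. *)
Let pow (p : T) : T := if 0 < p then p `^ k else p.

Let root (x : T) : T := if 0 < x then x `^ k^-1 else x.

Let dpow (p : T) : R := if 0 < p then k * p `^ (k - 1) else 1.

Let measurable_pow : measurable_fun setT pow.
Proof. by apply: measurable_fun_ifT => //; exact: measurable_fun_ltr. Qed.

Let measurable_dpow : measurable_fun setT dpow.
Proof.
apply: measurable_fun_ifT => //; first exact: measurable_fun_ltr.
by apply: measurable_funM => //; exact: measurable_powR.
Qed.

Let dpow_ge0 p : 0 <= dpow p.
Proof. by rewrite /dpow; case: ifP => _ //; rewrite mulr_ge0 ?powR_ge0 ?ltW. Qed.

Let rootK x : pow (root x) = x.
Proof.
rewrite /root; case: (ltP 0 x) => x0; last by rewrite /pow ltNge x0.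
by rewrite /pow powR_gt0// -powRrM mulVf ?gt_eqF// powRr1// ltW.
Qed.

Let pow_lt p q : p < q -> pow p < pow q.
Proof.
rewrite /pow; case: (ltP 0 p) => p0; case: (ltP 0 q) => q0 pq //.
- by apply: gt0_ltr_powR => //; rewrite nnegrE ltW.
- by have := lt_le_trans (lt_trans p0 pq) q0; rewrite ltxx.
- by apply: le_lt_trans p0 _; rewrite powR_gt0.
Qed.

Let pow_ltE : {mono pow : p q / p < q}.
Proof. by apply: leW_mono; apply: le_mono => p q; exact: pow_lt. Qed.

Let pow_leE : {mono pow : p q / p <= q}.
Proof. by apply: le_mono => p q; exact: pow_lt. Qed.

Let powR_continuous_at (a : R) p : 0 < p -> x `^ a @[x --> p] --> p `^ a.
Proof.
move=> p0; apply: (@differentiable_continuous _ _ _ p (@powR R ^~ a)).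
by apply/derivable1_diffP/derivable_powR; rewrite in_itv/= p0.
Qed.

Let powR_right_continuous (a : R) p : 0 < a -> 0 <= p ->
  x `^ a @[x --> p^'+] --> p `^ a.
Proof.
move=> a0; rewrite le_eqVlt => /predU1P[<-|p0].
  by rewrite powR0 ?gt_eqF//; exact: powR_cvg0.
exact/cvg_at_right_filter/powR_continuous_at.
Qed.

(** The fundamental theorem of calculus needs only one-sided continuity at the endpoint [p], so
    [p = 0] is included. *)
Let integral_dpow_pos p q : 0 <= p -> p < q ->
  (\int[mu]_(x in `]p, q]) (dpow x)%:E = (q `^ k - p `^ k)%:E)%E.
Proof.
move=> p0 pq; have q0 := le_lt_trans p0 pq.
transitivity (\int[mu]_(x in `]p, q]) (k * x `^ (k - 1))%:E)%E.
  apply: eq_integral => x; rewrite inE/= in_itv/= => /andP[px _].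
  by rewrite /dpow (le_lt_trans p0 px).
rewrite integral_itv_obnd_cbnd; last first.
  by apply/measurable_funTS/measurable_EFinP/measurable_funM => //; exact: measurable_powR.
rewrite (@continuous_FTC2 _ _ (@powR R ^~ k)) ?EFinB//.
- apply/continuous_within_itvP => //; split.
  + move=> x; rewrite in_itv/= => /andP[px _]; apply: cvgM; first exact: cvg_cst.
    by apply: powR_continuous_at; exact: le_lt_trans px.
  + apply: cvgM; first exact: cvg_cst.
    by apply: powR_right_continuous => //; rewrite subr_gt0.
  + apply: cvgM; first exact: cvg_cst.
    by apply/cvg_at_left_filter/powR_continuous_at.
- split.
  + move=> x; rewrite in_itv/= => /andP[px _]; apply: derivable_powR.
    by rewrite in_itv/= andbT (le_lt_trans p0 px).
  + exact: powR_right_continuous.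
  + exact/cvg_at_left_filter/powR_continuous_at.
- move=> x; rewrite in_itv/= => /andP[px _]; rewrite powR_derive1//.
  by rewrite in_itv/= andbT (le_lt_trans p0 px).
Qed.

Let integral_dpow_neg p q : p < q -> q <= 0 ->
  (\int[mu]_(x in `]p, q]) (dpow x)%:E = (q - p)%:E)%E.
Proof.
move=> pq q0.
transitivity (\int[mu]_(x in `]p, q]) (cst 1 x))%E.
  apply: eq_integral => x; rewrite inE/= in_itv/= => /andP[_ xq].
  by rewrite /dpow ltNge (le_trans xq q0).
rewrite integral_cst; last exact: measurable_itv.
rewrite mul1e /=.
by rewrite lebesgue_measure_itv/= lte_fin pq.
Qed.

Let integral_dpow p q : p < q ->
  (\int[mu]_(x in `]p, q]) (dpow x)%:E = (pow q - pow p)%:E)%E.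
Proof.
move=> pq; rewrite /pow; case: (ltP 0 p) => p0.
  by rewrite (lt_trans p0 pq) integral_dpow_pos// ltW.
case: (ltP 0 q) => q0; last by rewrite integral_dpow_neg.
move: p0; rewrite le_eqVlt => /predU1P[->|p0].
  by rewrite integral_dpow_pos// powR0 ?gt_eqF.
have -> : `]p, q]%classic = `]p, 0] `|` `]0, q] :> set T.
  apply/seteqP; split => x /=; rewrite !in_itv/=.
    by move=> /andP[-> ->]; rewrite andbT; apply/orP; case: leP.
  by move=> [/andP[-> x0]|/andP[x0 ->]]; rewrite ?(lt_trans p0 x0)// (le_trans x0)// ltW.
rewrite ge0_integral_setU//; try exact: measurable_itv.
- rewrite integral_dpow_neg// integral_dpow_pos// powR0 ?gt_eqF//.
  by rewrite subr0 sub0r -EFinD addrC.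
- by apply/measurable_funTS/measurable_EFinP.
- by move=> x _; rewrite lee_fin.
- by apply/disj_setPS => x [] /=; rewrite !in_itv/= => /andP[_ x0] /andP[]; rewrite ltNge x0.
Qed.

(** Lebesgue measure is the pushforward under [pow] of the measure with density [dpow]: by
    uniqueness it suffices to compare half-open intervals, where [integral_dpow] applies. The
    identity part of [pow] contributes nothing because [f] vanishes on nonpositive reals. *)
Lemma ge0_integral_pow_substitution (f : T -> \bar R) : measurable_fun setT f ->
  (forall x, 0 <= f x)%E -> (forall x, x <= 0 -> f x = 0%E) ->
  (\int[mu]_x f x =
   \int[mu]_p (if (0 < p)%R then f (p `^ k)%R * (k * p `^ (k - 1))%:E else 0))%E.
Proof.
move=> mf f0 fN.
have [nu nuE] := density_measure_exists mu measurable_dpow dpow_ge0.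
pose mixin := isMeasurableFun.Build _ _ _ _ _ measurable_pow.
pose H : {mfun _ >-> _} := HB.pack pow mixin.
transitivity (\int[pushforward nu H]_x f x)%E.
  apply: (eq_measure_integral (pushforward nu H)) => A mA _.
  apply: lebesgue_measure_unique => // _ [[x y]] /= _ <-.
  rewrite /pushforward (_ : _ @^-1` _ = `]root x, root y]%classic); last first.
    have E p : (x < pow p <= y) = (root x < p <= root y).
      by rewrite -(pow_ltE (root x)) -(pow_leE _ (root y)) !rootK.
    by apply/seteqP; split => p /=; rewrite !in_itv/= E.
  rewrite nuE lebesgue_measure_itv/= lte_fin; case: ltP => xy.
    by rewrite integral_dpow ?rootK -?EFinB// -pow_ltE !rootK.
  rewrite set_itv_ge ?integral_set0// bnd_simp -leNgt.
  by rewrite -pow_leE !rootK.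
rewrite ge0_integral_pushforward//= preimage_setT.
rewrite (ge0_integral_density measurable_dpow dpow_ge0 (fun A _ => nuE A))//.
  apply: eq_integral => p _ /=; rewrite /pow /dpow.
  by case: ltP => // p0; rewrite fN// mul0e.
by apply: measurableT_comp.
Qed.

End power_substitution.

Lemma prod_tnth_cons (R : realType) n (F : R -> R -> R) a b (x y : n.-tuple R) :
  \prod_(i < n.+1) F (tnth [tuple of a :: x] i) (tnth [tuple of b :: y] i) =
  F a b * \prod_(i < n) F (tnth x i) (tnth y i).
Proof.
rewrite big_ord_recl !tnth0; congr (_ * _).
by apply: eq_bigr => i _; rewrite !tnthS.
Qed.

(** * Prekopa-Leindler after the power substitution, in dimension one and in dimension [n] *)

Section power_prekopa_leindler.
Context {R : realType}.
Variable k : R.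
Hypothesis k1 : 1 < k.
Notation mu := (@lebesgue_measure R).
Notation T := (measurableTypeR R).

Let k0 : 0 < k. Proof. exact: lt_trans k1. Qed.

Definition pow_mean (x y : R) : R := ((x `^ k^-1 + y `^ k^-1) / 2) `^ k.

(** With [p], [q] the roots of [x], [y] and [z] their midpoint, this is the product of the Jacobians
    at [p] and [q] divided by the squared Jacobian at [z]; see [jacobianM]. *)
Definition pow_weight (x y : R) : R :=
  (x `^ k^-1 * y `^ k^-1 / ((x `^ k^-1 + y `^ k^-1) / 2) ^+ 2) `^ (k - 1).

Lemma pow_weight_ge0 x y : 0 <= pow_weight x y.
Proof. exact: powR_ge0. Qed.

Lemma pow_mean_gt0 x y : 0 < x -> 0 < y -> 0 < pow_mean x y.
Proof. by move=> x0 y0; rewrite powR_gt0// divr_gt0// addr_gt0// powR_gt0. Qed.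

Let jacobian (p : R) : R := k * p `^ (k - 1).

Let jacobianM p q : 0 < p -> 0 < q ->
  jacobian p * jacobian q =
  pow_weight (p `^ k) (q `^ k) * (jacobian ((p + q) / 2) * jacobian ((p + q) / 2)).
Proof.
move=> p0 q0; rewrite /pow_weight -!powRrM divff ?gt_eqF// !powRr1 ?ltW//.
set z := (p + q) / 2; have z0 : 0 < z by rewrite divr_gt0// addr_gt0.
have -> : jacobian z * jacobian z = k * k * (z ^+ 2) `^ (k - 1).
  by rewrite /jacobian expr2 [(z * z) `^ _]powRM ?ltW//; ring.
have pq0 : 0 <= p * q by rewrite mulr_ge0 ?ltW.
rewrite [RHS]mulrCA -powRM ?divr_ge0 ?sqr_ge0// divfK; last by rewrite expf_neq0// gt_eqF.
by rewrite powRM ?ltW// /jacobian; ring.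
Qed.

Local Open Scope ereal_scope.

Let density (f : T -> \bar R) (p : T) : \bar R :=
  if (0 < p)%R then f (p `^ k)%R * (jacobian p)%:E else 0.

Let measurable_density f : measurable_fun setT f -> measurable_fun setT (density f).
Proof.
move=> mf; apply: measurable_fun_ifT => //; first exact: measurable_fun_ltr.
apply: emeasurable_funM; first exact: measurableT_comp mf (measurable_powR k).
by apply/measurable_EFinP/measurable_funM => //; exact: measurable_powR.
Qed.

Let density_ge0 f : (forall x, 0 <= f x) -> forall p, 0 <= density f p.
Proof.
move=> f0 p; rewrite /density; case: ifP => // _.
by rewrite mule_ge0// lee_fin mulr_ge0 ?powR_ge0// ltW.
Qed.

Lemma power_prekopa_leindler_line (f g h : T -> \bar R) :
  measurable_fun setT f -> measurable_fun setT g -> measurable_fun setT h ->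
  (forall x, 0 <= f x) -> (forall x, 0 <= g x) -> (forall x, 0 <= h x) ->
  (forall x, (x <= 0)%R -> f x = 0) -> (forall x, (x <= 0)%R -> g x = 0) ->
  (forall x y, (0 < x)%R -> (0 < y)%R ->
    (pow_weight x y)%:E * (f x * g y) <= h (pow_mean x y) * h (pow_mean x y)) ->
  \int[mu]_x f x * \int[mu]_x g x <= \int[mu]_x h x * \int[mu]_x h x.
Proof.
move=> mf mg mh f0 g0 h0 fN gN fgh.
(* The substitution formula asks for a function vanishing on nonpositive reals; cutting [h] there
   only decreases the right-hand side. *)
pose h1 (x : T) : \bar R := if (0 < x)%R then h x else 0.
have mh1 : measurable_fun setT h1.
  by apply: measurable_fun_ifT => //; exact: measurable_fun_ltr.
have h10 x : 0 <= h1 x by rewrite /h1; case: ifP.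
have h1N x : (x <= 0)%R -> h1 x = 0 by rewrite /h1 ltNge => ->.
have h1h : \int[mu]_x h1 x <= \int[mu]_x h x.
  by apply: ge0_le_integral => // x _; rewrite /h1; case: ifP.
apply: (@le_trans _ _ (\int[mu]_x h1 x * \int[mu]_x h1 x)); last first.
  by apply: lee_pmul => //; exact: integral_ge0.
rewrite (ge0_integral_pow_substitution k1 mf f0 fN).
rewrite (ge0_integral_pow_substitution k1 mg g0 gN).
rewrite (ge0_integral_pow_substitution k1 mh1 h10 h1N).
apply: (@prekopa_leindler_line _ (density f) (density g) (density h1)).
1-3: exact: measurable_density.
1-3: exact: density_ge0.
move=> p q; rewrite /density; case: (ltP 0%R p) => p0; last first.
  by rewrite mul0e mule_ge0// -/(density h1 _) density_ge0.
case: (ltP 0%R q) => q0; last first.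
  by rewrite mule0 mule_ge0// -/(density h1 _) density_ge0.
have z0 : (0 < (p + q) / 2)%R by rewrite divr_gt0// addr_gt0.
rewrite z0 muleACA -EFinM jacobianM// EFinM muleA [leRHS]muleACA -EFinM.
apply: lee_pmul => //.
- by rewrite !mule_ge0// lee_fin pow_weight_ge0.
- by rewrite lee_fin -expr2 sqr_ge0.
have := fgh (p `^ k)%R (q `^ k)%R; rewrite !powR_gt0// => /(_ isT isT).
rewrite /pow_mean -!powRrM divff ?gt_eqF// !powRr1 ?(ltW p0) ?(ltW q0)//.
by rewrite /h1 powR_gt0// muleC.
Qed.

Section tensorization.
Variable n : nat.
Implicit Types x y : n.-tuple R.

Definition tuple_pos x : Prop := forall i, (0 < tnth x i)%R.

Definition tuple_pow_mean x y : n.-tuple R :=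
  [tuple pow_mean (tnth x i) (tnth y i) | i < n].

Definition tuple_pow_weight x y : R := (\prod_(i < n) pow_weight (tnth x i) (tnth y i))%R.

End tensorization.

Lemma tuple_pow_mean_cons n a b (x y : n.-tuple R) :
  tuple_pow_mean [tuple of a :: x] [tuple of b :: y] =
  [tuple of pow_mean a b :: tuple_pow_mean x y].
Proof.
apply: eq_from_tnth => i; rewrite tnth_mktuple.
case: (unliftP ord0 i) => [j ->|->]; first by rewrite !tnthS tnth_mktuple.
by rewrite !tnth0.
Qed.

Lemma tuple_pow_weight_cons n a b (x y : n.-tuple R) :
  tuple_pow_weight [tuple of a :: x] [tuple of b :: y] =
  (pow_weight a b * tuple_pow_weight x y)%R.
Proof.
exact: prod_tnth_cons.
Qed.

Lemma ge0_integral_lebesgue_tupleS n (f : n.+1.-tuple R -> \bar R) :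
  measurable_fun setT f -> (forall x, 0 <= f x) ->
  \int[lebesgue_tuple n.+1]_x f x =
  \int[mu]_a \int[lebesgue_tuple n]_x f [tuple of a :: x].
Proof.
move=> mf f0.
rewrite /= /lebesgue_cons ge0_integral_pushforward//; last exact: measurable_cons_pair.
rewrite preimage_setT (fubini_tonelli1 (f \o @cons_pair R n))//; last by move=> p /=.
by apply: measurableT_comp => //; exact: measurable_cons_pair.
Qed.

Lemma measurable_section_tuple n (f : n.+1.-tuple R -> \bar R) a :
  measurable_fun setT f ->
  measurable_fun setT (fun x : n.-tuple R => f [tuple of a :: x]).
Proof.
move=> mf; apply: (measurableT_comp mf).
have : measurable_fun setT (@cons_pair R n \o pair (a : T)); last by [].
apply: measurableT_comp; first exact: measurable_cons_pair.
exact: measurable_pair1.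
Qed.

Lemma measurable_integral_section n (f : n.+1.-tuple R -> \bar R) :
  measurable_fun setT f -> (forall x, 0 <= f x) ->
  measurable_fun setT (fun a : T => \int[lebesgue_tuple n]_x f [tuple of a :: x]).
Proof.
move=> mf f0.
apply: (@measurable_fun_fubini_tonelli_F _ _ _ _ _ (lebesgue_tuple n) (f \o @cons_pair R n)) => //.
  by apply: measurableT_comp => //; exact: measurable_cons_pair.
by move=> p /=.
Qed.

(** Induction on the dimension. The weight is a product over coordinates, so for fixed first
    coordinates [a], [b] the factor [pow_weight a b] is absorbed into the section of [f]. The
    induction hypothesis for the sections is then exactly the hypothesis of the line case for the
    integrated sections. *)
Theorem power_prekopa_leindler n (f g h : n.-tuple R -> \bar R) :
  measurable_fun setT f -> measurable_fun setT g -> measurable_fun setT h ->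
  (forall x, 0 <= f x) -> (forall x, 0 <= g x) -> (forall x, 0 <= h x) ->
  (forall x, ~ tuple_pos x -> f x = 0) -> (forall x, ~ tuple_pos x -> g x = 0) ->
  (forall x y, tuple_pos x -> tuple_pos y ->
    (tuple_pow_weight x y)%:E * (f x * g y) <=
    h (tuple_pow_mean x y) * h (tuple_pow_mean x y)) ->
  \int[lebesgue_tuple n]_x f x * \int[lebesgue_tuple n]_x g x <=
  \int[lebesgue_tuple n]_x h x * \int[lebesgue_tuple n]_x h x.
Proof.
elim: n f g h => [|n IH] f g h mf mg mh f0 g0 h0 fN gN fgh.
  rewrite /= /lebesgue_nil !integral_dirac// !diracT !mul1e.
  have := fgh [tuple] [tuple]; rewrite /tuple_pow_weight big_ord0 mul1e.
  by rewrite [tuple_pow_mean _ _]tuple0; apply; case.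
rewrite (ge0_integral_lebesgue_tupleS mf f0) (ge0_integral_lebesgue_tupleS mg g0).
rewrite (ge0_integral_lebesgue_tupleS mh h0).
have posS a (x : n.-tuple R) : tuple_pos [tuple of a :: x] -> (0 < a)%R /\ tuple_pos x.
  move=> ax; split; first exact: (ax ord0).
  by move=> i; have := ax (lift ord0 i); rewrite tnthS.
have Spos a (x : n.-tuple R) : (0 < a)%R -> tuple_pos x -> tuple_pos [tuple of a :: x].
  by move=> a0 x0 i; case: (unliftP ord0 i) => [j ->|->//]; rewrite tnthS.
apply: power_prekopa_leindler_line.
1-3: exact: measurable_integral_section.
1-3: by move=> a; exact: integral_ge0.
- move=> a a0; apply: integral0_eq => x _; apply: fN => /posS[].
  by rewrite ltNge a0.
- move=> a a0; apply: integral0_eq => x _; apply: gN => /posS[].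
  by rewrite ltNge a0.
move=> a b a0 b0; rewrite muleA -ge0_integralZl_EFin ?pow_weight_ge0//; last first.
  exact: measurable_section_tuple.
apply: IH => //.
- by apply: measurable_funeM; exact: measurable_section_tuple.
- exact: measurable_section_tuple.
- exact: measurable_section_tuple.
- by move=> x; rewrite mule_ge0// lee_fin pow_weight_ge0.
- by move=> x x0; rewrite fN ?mule0// => /posS[].
- by move=> x x0; rewrite gN// => /posS[].
move=> x y x0 y0.
have := fgh _ _ (Spos _ _ a0 x0) (Spos _ _ b0 y0).
rewrite tuple_pow_weight_cons tuple_pow_mean_cons EFinM.
by rewrite -!muleA [X in _ -> X <= _]muleCA.
Qed.

End power_prekopa_leindler.

(** * Pointwise inequalities for the functions fed to Prekopa-Leindler *)

Section pointwise_bounds.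
Context {R : realType}.
Variable k : R.
Hypothesis k1 : 1 < k.

Let k0 : 0 < k. Proof. exact: lt_trans k1. Qed.

Let ratio (x y : R) : R := (x `^ k^-1 - y `^ k^-1) / (x `^ k^-1 + y `^ k^-1).

(** The base of the power is [1 - r ^+ 2], and [ln (1 - r ^+ 2) <= - r ^+ 2]. *)
Lemma pow_weight_le_exp (x y : R) : 0 < x -> 0 < y ->
  pow_weight k x y <= expR (- ((k - 1) * ratio x y ^+ 2)).
Proof.
move=> x0 y0; rewrite /pow_weight /ratio.
have : 0 < x `^ k^-1 by exact: powR_gt0.
have : 0 < y `^ k^-1 by exact: powR_gt0.
move: (x `^ k^-1) (y `^ k^-1) => p q q0 p0.
set r := (p - q) / (p + q).
have pq0 : p + q != 0 by rewrite gt_eqF// addr_gt0.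
have -> : p * q / ((p + q) / 2) ^+ 2 = 1 - r ^+ 2 by rewrite /r; field.
have r1 : 0 < 1 - r ^+ 2.
  have -> : 1 - r ^+ 2 = p * q / ((p + q) / 2) ^+ 2 by rewrite /r; field.
  by apply: divr_gt0; [exact: mulr_gt0|rewrite exprn_gt0// divr_gt0// addr_gt0].
rewrite /powR gt_eqF// ler_expR -[leRHS]mulrN ler_wpM2l ?subr_ge0 ?(ltW k1)//.
by apply: le_ln1Dx; lra.
Qed.

Lemma powR_sub_le (m p q : R) : 1 < m -> 0 < q -> q <= p ->
  p `^ m - q `^ m <= m * p `^ (m - 1) * (p - q).
Proof.
move=> m1 q0; rewrite le_eqVlt => /predU1P[->|qp]; first by rewrite !subrr mulr0.
have [z|z|] := @MVT R (@powR R ^~ m) (fun x => m * x `^ (m - 1)) q p qp.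
- rewrite in_itv/= => /andP[qz _]; apply: is_derive1_powR; exact: lt_trans qz.
- apply: derivable_within_continuous => t; rewrite in_itv/= => /andP[qt _].
  by apply: derivable_powR; rewrite in_itv/= andbT (lt_le_trans q0 qt).
move=> z; rewrite in_itv/= => /andP[qz zp] ->.
have m0 : 0 <= m by rewrite (le_trans ler01)// ltW.
rewrite ler_wpM2r ?subr_ge0 ?(ltW qp)// ler_wpM2l//.
apply: ge0_ler_powR; rewrite ?nnegrE ?subr_ge0 ?ltW//.
  exact: lt_trans qz.
exact: lt_trans qp.
Qed.

Let sqr_powR (p : R) : 0 <= p -> (p `^ k) ^+ 2 = p `^ (k * 2).
Proof. by move=> p0; rewrite -powR_mulrn ?powR_ge0// -powRrM. Qed.

Definition sqr_diff_cst : R := 2 * (k * 2) * 2 `^ (k * 2 - 1).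

Lemma sqr_diff_cst_ge0 : 0 <= sqr_diff_cst.
Proof. by rewrite !mulr_ge0 ?powR_ge0 ?ltW. Qed.

(** In terms of the roots this compares [p] and [q] raised to the power [2 * k]. The mean value
    bound [powR_sub_le], with [p - q = 2 * r * z] and [p <= 2 * z], gives the constant; for [p < q]
    the left-hand side is nonpositive. *)
Lemma sqr_sub_le_pow_mean (x y : R) : 0 < x -> 0 < y ->
  x ^+ 2 - y ^+ 2 <= sqr_diff_cst * `|ratio x y| * pow_mean k x y ^+ 2.
Proof.
move=> x0 y0.
have -> : x ^+ 2 = (x `^ k^-1) `^ (k * 2).
  by rewrite -sqr_powR ?powR_ge0// -powRrM mulVf ?gt_eqF// powRr1// ltW.
have -> : y ^+ 2 = (y `^ k^-1) `^ (k * 2).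
  by rewrite -sqr_powR ?powR_ge0// -powRrM mulVf ?gt_eqF// powRr1// ltW.
rewrite /pow_mean /ratio.
have : 0 < x `^ k^-1 by exact: powR_gt0.
have : 0 < y `^ k^-1 by exact: powR_gt0.
move: (x `^ k^-1) (y `^ k^-1) => p q q0 p0.
set r := (p - q) / (p + q); set z := (p + q) / 2.
have z0 : 0 < z by rewrite divr_gt0// addr_gt0.
have m1 : 1 < k * 2 by rewrite (lt_trans k1)// ltr_pMr// ltr1n.
rewrite sqr_powR; last exact: ltW.
have [qp|pq] := leP q p; last first.
  apply: (@le_trans _ _ 0); last first.
    by apply: mulr_ge0 (powR_ge0 _ _); apply: mulr_ge0; [exact: sqr_diff_cst_ge0|].
  by rewrite subr_le0; apply: ge0_ler_powR; rewrite ?nnegrE ?ltW// mulr_gt0.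
apply: (le_trans (powR_sub_le m1 q0 qp)).
have pq0 : p + q != 0 by rewrite gt_eqF// addr_gt0.
have r0 : 0 <= r by rewrite divr_ge0 ?subr_ge0// ltW// addr_gt0.
rewrite (ger0_norm r0).
have -> : p - q = 2 * r * z by rewrite /r /z; field.
have -> : z `^ (k * 2) = z * z `^ (k * 2 - 1) by rewrite mulr_powRB1// ?ltW// mulr_gt0.
have -> : sqr_diff_cst * r * (z * z `^ (k * 2 - 1)) =
  k * 2 * (2 * z) `^ (k * 2 - 1) * (2 * r * z).
  by rewrite powRM ?ltW// /sqr_diff_cst; ring.
apply: ler_wpM2r; first by apply: mulr_ge0 (ltW z0); rewrite mulr_ge0.
apply: ler_wpM2l; first by rewrite mulr_ge0// ltW.
apply: ge0_ler_powR.
- by rewrite subr_ge0 ltW.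
- by rewrite nnegrE ltW.
- by rewrite nnegrE mulr_ge0// ltW.
by rewrite /z; lra.
Qed.

(** The weights multiply to at most [exp (- S)] with [S = (k - 1) * sum r_i^2], and
    [1 + S <= exp S]. *)
Lemma tuple_pow_weight_le n (x y : n.-tuple R) : tuple_pos x -> tuple_pos y ->
  tuple_pow_weight k x y * (1 + (k - 1) * \sum_(i < n) ratio (tnth x i) (tnth y i) ^+ 2) <= 1.
Proof.
move=> x0 y0; set S := \sum_(i < n) _.
have S0 : 0 <= (k - 1) * S.
  by rewrite mulr_ge0 ?subr_ge0 ?(ltW k1)// sumr_ge0// => i _; exact: sqr_ge0.
have : tuple_pow_weight k x y <= expR (- ((k - 1) * S)).
  rewrite mulr_sumr -sumrN expR_sum; apply: ler_prod => i _.
  by rewrite pow_weight_ge0 pow_weight_le_exp.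
move=> /(ler_wpM2r (_ : 0 <= 1 + (k - 1) * S)) h; apply: le_trans (h _) _.
  by rewrite addr_ge0.
by rewrite expRN mulrC ler_pdivrMr ?expR_gt0// mul1r expR_ge1Dx.
Qed.

Lemma tuple_pow_weight_ge0 n (x y : n.-tuple R) : 0 <= tuple_pow_weight k x y.
Proof. by apply: prodr_ge0 => i _; exact: pow_weight_ge0. Qed.

Lemma tuple_pow_weight_le1 n (x y : n.-tuple R) : tuple_pos x -> tuple_pos y ->
  tuple_pow_weight k x y <= 1.
Proof.
move=> x0 y0; apply: le_trans (tuple_pow_weight_le x0 y0).
rewrite ler_peMr ?tuple_pow_weight_ge0// lerDl mulr_ge0 ?subr_ge0 ?(ltW k1)//.
by apply: sumr_ge0 => i _; exact: sqr_ge0.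
Qed.

Lemma le_pow_mean (x y : R) : 0 < x -> 0 < y -> x <= 2 `^ k * pow_mean k x y.
Proof.
move=> x0 y0; rewrite /pow_mean -powRM ?divr_ge0 ?addr_ge0 ?powR_ge0//.
rewrite mulrC divfK//.
have {1}-> : x = (x `^ k^-1) `^ k by rewrite -powRrM mulVf ?gt_eqF// powRr1// ltW.
by apply: ge0_ler_powR; rewrite ?nnegrE ?addr_ge0 ?powR_ge0 ?ltW// ltrDl powR_gt0.
Qed.

Definition wsqr n (theta x : n.-tuple R) : R :=
  \sum_(i < n) (tnth theta i * tnth x i) ^+ 2.

Definition wquart n (theta x : n.-tuple R) : R :=
  \sum_(i < n) (tnth theta i * tnth x i) ^+ 4.

Lemma wsqr_ge0 n (theta x : n.-tuple R) : 0 <= wsqr theta x.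
Proof. by apply: sumr_ge0 => i _; exact: sqr_ge0. Qed.

Lemma wquart_ge0 n (theta x : n.-tuple R) : 0 <= wquart theta x.
Proof. by apply: sumr_ge0 => i _; rewrite (exprM _ 2 2) sqr_ge0. Qed.

(** The coefficient left over when a square is completed against the gain [(k - 1) * r ^+ 2]. *)
Definition wquart_cst : R := sqr_diff_cst ^+ 2 / (4 * (k - 1)).

Lemma wquart_cst_ge0 : 0 <= wquart_cst.
Proof. by rewrite divr_ge0 ?sqr_ge0// mulr_ge0// subr_ge0 ltW. Qed.

(* The gain [tuple_pow_weight] pays for replacing [y] by [x] in [1 + wsqr theta]. *)
Lemma tuple_pow_weight_wsqr n (theta x y : n.-tuple R) : tuple_pos x -> tuple_pos y ->
  tuple_pow_weight k x y * ((1 + wsqr theta x) * (1 + wsqr theta y)^-1) <=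
  (1 + wquart_cst / 2 * wquart theta (tuple_pow_mean k x y)) *
  (1 + wquart_cst / 2 * wquart theta (tuple_pow_mean k x y)).
Proof.
move=> x0 y0; set z := tuple_pow_mean k x y.
set Q := wquart_cst * wquart theta z.
have Q0 : 0 <= Q by rewrite mulr_ge0 ?wquart_cst_ge0 ?wquart_ge0.
have -> : wquart_cst / 2 * wquart theta z = Q / 2 by rewrite mulrAC.
(* [1 + Q <= (1 + Q / 2) ^+ 2], which explains the halved constant in the third function. *)
apply: (@le_trans _ _ (1 + Q)); last by have := mulr_ge0 Q0 Q0; lra.
pose b := k - 1; have b0 : 0 < b by rewrite subr_gt0.
pose r i := ratio (tnth x i) (tnth y i).
have Yy := wsqr_ge0 theta y.
pose S := b * \sum_i r i ^+ 2.
have S0 : 0 <= S by rewrite mulr_ge0 ?(ltW b0)// sumr_ge0// => i _; exact: sqr_ge0.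
have dY : wsqr theta x - wsqr theta y <= S + Q.
  rewrite /S /Q /wquart !mulr_sumr -sumrB -big_split/=; apply: ler_sum => i _.
  set th := tnth theta i.
  have thM v m : (th * v) ^+ m = th ^+ m * v ^+ m by exact: exprMn.
  rewrite !thM -mulrBr.
  apply: (@le_trans _ _ (th ^+ 2 * (sqr_diff_cst * `|r i| * tnth z i ^+ 2))).
    by rewrite ler_wpM2l ?sqr_ge0// tnth_mktuple sqr_sub_le_pow_mean.
  rewrite -[r i ^+ 2](real_normK (num_real _)) /wquart_cst -/b.
  set a := sqr_diff_cst; set s := `|r i|; set v := tnth z i.
  (* AM-GM for [b s^2] and [a^2 th^4 v^4 / (4 b)] *)
  rewrite -subr_ge0.
  have -> : b * s ^+ 2 + a ^+ 2 / (4 * b) * (th ^+ 4 * v ^+ 4) -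
      th ^+ 2 * (a * s * v ^+ 2) = (2 * b * s - a * th ^+ 2 * v ^+ 2) ^+ 2 / (4 * b).
    by field; rewrite gt_eqF.
  by rewrite divr_ge0 ?sqr_ge0// mulr_ge0// ltW.
(* Adding 1 to [wsqr] keeps the denominator at least 1, so the additive bound [S + Q] becomes a
   multiplicative one; the factor [1 + S] is then absorbed by the weight. *)
have frac : (1 + wsqr theta x) * (1 + wsqr theta y)^-1 <= (1 + S) * (1 + Q).
  rewrite ler_pdivrMr; last by rewrite ltr_pwDl.
  have SQ := mulr_ge0 S0 Q0.
  apply: (@le_trans _ _ (1 + wsqr theta y + (S + Q))); first by lra.
  have : 0 <= wsqr theta y * (S + Q + S * Q) by rewrite mulr_ge0 ?addr_ge0.
  by lra.
apply: le_trans (ler_wpM2l (tuple_pow_weight_ge0 x y) frac) _.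
rewrite mulrA -[leRHS]mul1r ler_wpM2r ?addr_ge0//.
exact: tuple_pow_weight_le.
Qed.

(** The weight is at most 1 and each coordinate is at most [2 ^ k] times its mean with another
    positive number. The bound is written as a product so that its factor is a multiple of a squared
    coordinate, whose expectation is known. *)
Lemma tuple_pow_weight_quart n (x y : n.-tuple R) i : tuple_pos x -> tuple_pos y ->
  tuple_pow_weight k x y * (tnth x i ^+ 4 * 1) <=
  ((2 `^ k) ^+ 2 * tnth (tuple_pow_mean k x y) i ^+ 2) *
  ((2 `^ k) ^+ 2 * tnth (tuple_pow_mean k x y) i ^+ 2).
Proof.
move=> x0 y0; rewrite mulr1 -!exprMn -expr2 -exprM tnth_mktuple.
apply: (@le_trans _ _ (tnth x i ^+ 4)).
  by rewrite ler_piMl ?tuple_pow_weight_le1// exprn_ge0// ltW.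
rewrite lerXn2r ?nnegrE ?le_pow_mean//; first by rewrite ltW.
by rewrite mulr_ge0 ?powR_ge0.
Qed.

End pointwise_bounds.

(** * Unconditional random vectors *)

Lemma sign_flip_tnth (R : realType) n (e : 'I_n -> bool) (x : n.-tuple R) i :
  tnth (sign_flip e x) i = (-1) ^+ e i * tnth x i.
Proof. by rewrite tnth_mktuple. Qed.

Lemma measurable_sign_flip (R : realType) n (e : 'I_n -> bool) :
  measurable_fun setT (@sign_flip R n e).
Proof.
apply/measurable_fun_tnthP => i.
rewrite (_ : _ \o _ = (fun x : n.-tuple R => (-1) ^+ e i * tnth x i)); last first.
  by apply/funext => x /=; rewrite sign_flip_tnth.
by apply: measurable_funM => //; exact: measurable_tnth.
Qed.

Lemma measurable_tuple_pos (R : realType) n : measurable [set x : n.-tuple R | tuple_pos x].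
Proof.
rewrite (_ : mkset _ = \bigcap_(i in [set: 'I_n])
    ((fun x : n.-tuple R => tnth x i) @^-1` `]0, +oo[)).
  apply: fin_bigcap_measurable => // i _.
  by rewrite -[X in measurable X]setTI; apply: (@measurable_tnth _ R n i).
apply/seteqP; split => x /= h i; first by move=> _; rewrite /= in_itv/= h.
by have := h i I; rewrite /= in_itv/= andbT.
Qed.

(** Convexity is applied at the midpoint of the coordinatewise roots, which [coord_pow] sends to
    [tuple_pow_mean k x y]. If [u] is infinite at [x] or [y], the left-hand side is zero. *)
Lemma econvex_density (R : realType) n (k : R) (u : n.-tuple R -> \bar R) (x y : n.-tuple R) :
  1 < k -> (forall z, u z <> -oo%E) ->
  econvex_on orthant (fun z => u (coord_pow k z)) -> tuple_pos x -> tuple_pos y ->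
  (expeR (- u x) * expeR (- u y) <=
   expeR (- u (tuple_pow_mean k x y)) * expeR (- u (tuple_pow_mean k x y)))%E.
Proof.
move=> k1 uNy cvx x0 y0; set z := tuple_pow_mean k x y.
have k0 : 0 < k by exact: lt_trans k1.
have rootK (v : n.-tuple R) : tuple_pos v -> coord_pow k (coord_pow k^-1 v) = v.
  move=> v0; apply: eq_from_tnth => i; rewrite !tnth_mktuple -powRrM mulVf ?gt_eqF//.
  by rewrite powRr1// ltW.
have root0 (v : n.-tuple R) : orthant (coord_pow k^-1 v) by move=> i; rewrite tnth_mktuple powR_ge0.
have half : 0 <= (2^-1 : R) <= 1 by apply/andP; split; lra.
have := cvx _ _ _ (root0 x) (root0 y) half; rewrite !rootK//.
have -> : coord_pow k (segment_point 2^-1 (coord_pow k^-1 x) (coord_pow k^-1 y)) = z.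
  apply: eq_from_tnth => i; rewrite !tnth_mktuple /pow_mean; congr (_ `^ k); by field.
have := uNy x; have := uNy y; have := uNy z.
case: (u x) => [a| |] // => [|_ _ _ _].
  case: (u y) => [b| |] // => [|_ _ _ _].
    case: (u z) => [c| |] // => _ _ _.
      by rewrite -!expeRD lee_expeR -!EFinM -EFinD /= !lee_fin => ?; lra.
  by rewrite /= mule0 mule_ge0 ?expeR_ge0.
by rewrite /= mul0e mule_ge0 ?expeR_ge0.
Qed.

Section random_vector_density.
Context {R : realType} {n : nat} {d : measure_display} {T : measurableType d}.
Variables (P : probability T R) (X : {RV P >-> n.-tuple R}).
Notation leb := (@lebesgue_tuple R n).
Local Open Scope ereal_scope.

(** Integration wants a Borel function, while convexity speaks of [u] at every point. The
    real-valued Borel version [w] agrees with the exponential exactly off a measurable null set and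
    vanishes on it. *)
Lemma has_density_borel (u : n.-tuple R -> \bar R) : (forall x, u x <> -oo) ->
  has_density X (fun x => expeR (- u x)) ->
  exists (w : n.-tuple R -> R) (N : set (n.-tuple R)),
  [/\ measurable N, leb N = 0, measurable_fun setT w & (forall x, 0 <= w x)%R] /\
  [/\ (forall x, N x -> w x = 0%R), (forall x, ~ N x -> (w x)%:E = expeR (- u x)) &
      (forall A, measurable A -> distribution P X A = \int[leb]_(x in A) (w x)%:E)].
Proof.
move=> uNy [g [mg [N [mN N0 gN]] gP]].
have gE x : ~ N x -> g x = expeR (- u x).
  by move=> Nx; have [->//|ne] := pselect (expeR (- u x) = g x); case: Nx; exact: gN.
pose w (x : n.-tuple R) : R := (fine (g x) * \1_(~` N) x)%R.
have wN x : N x -> w x = 0%R.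
  by move=> Nx; rewrite /w indicE memNset ?mulr0//= => /(_ Nx).
have wE x : ~ N x -> (w x)%:E = expeR (- u x).
  move=> Nx; rewrite /w indicE mem_set//= mulr1 gE// fineK//.
  by have := uNy x; case: (u x).
have mw : measurable_fun setT w.
  apply: measurable_funM; first exact: measurableT_comp.
  by apply: measurable_indic; exact: measurableC.
exists w, N; split; split => //.
  move=> x; have [/wN ->//|/wE] := pselect (N x).
  by rewrite -lee_fin => ->; exact: expeR_ge0.
move=> A mA; rewrite gP//; apply: ae_eq_integral => //.
- exact: measurable_funTS.
- by apply/measurable_funTS/measurable_EFinP.
exists N; split => // x /= ne; apply: contrapT => Nx; apply: ne => _.
by rewrite wE// gE.
Qed.

End random_vector_density.

Lemma ge0_mulrn_ereal (R : realType) (x : \bar R) m :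
  (0 <= x -> (x *+ m)%R = (m%:R)%:E * x)%E.
Proof.
move=> x0; elim: m => [|m IH]; first by rewrite mulr0n mul0e.
by rewrite mulrSr IH -natr1 EFinD ge0_muleDl ?lee_fin// mul1e.
Qed.

Section unconditional_expectation.
Context {R : realType} {n : nat} {d : measure_display} {T : measurableType d}.
Variables (P : probability T R) (X : {RV P >-> n.-tuple R}) (w : n.-tuple R -> R).
Notation leb := (@lebesgue_tuple R n).
Hypothesis mw : measurable_fun setT w.
Hypothesis w0 : forall x, 0 <= w x.
Hypothesis wP : forall A, measurable A ->
  distribution P X A = (\int[leb]_(x in A) (w x)%:E)%E.
Local Open Scope ereal_scope.

Let pos := [set x : n.-tuple R | tuple_pos x].

Lemma expectation_density (phi : n.-tuple R -> R) : measurable_fun setT phi ->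
  (forall x, 0 <= phi x)%R ->
  \int[P]_t (phi (X t))%:E = \int[leb]_x (phi x * w x)%:E.
Proof.
move=> mphi phi0.
rewrite -[LHS](@ge0_integral_distribution _ _ _ _ _ _ X (EFin \o phi))//; last first.
    exact/measurable_EFinP.
by rewrite (ge0_integral_density mw w0 wP)//; exact/measurable_EFinP.
Qed.

(** A coordinate hyperplane is a product set with one factor of measure zero. Hence almost surely
    all coordinates have a sign. *)
Lemma distribution_coordinate0 i : distribution P X [set x | tnth x i = 0%R] = 0.
Proof.
pose A (j : 'I_n) : set R := if j == i then [set 0%R] else setT.
have mA j : measurable (A j) by rewrite /A; case: ifP.
have E : [set x : n.-tuple R | tnth x i = 0%R] = [set x | forall j, A j (tnth x j)].
  apply/seteqP; split => x /=; last by move=> /(_ i); rewrite /A eqxx.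
  by move=> xi j; rewrite /A; case: eqP => [->|].
have mE : measurable [set x : n.-tuple R | tnth x i = 0%R].
  rewrite -[X in measurable X]setTI.
  exact: (@measurable_tnth _ R n i measurableT [set 0%R]).
rewrite wP// null_set_integral//.
  by apply/measurable_funTS/measurable_EFinP.
rewrite E; apply: etrans (lebesgue_tupleE mA) _.
by rewrite (bigD1 i)//= {1}/A eqxx lebesgue_measure_set1 mul0e.
Qed.

Hypothesis uncX : unconditional X.

Lemma expectation_sign_flip (e : 'I_n -> bool) (phi : n.-tuple R -> R) :
  measurable_fun setT phi -> (forall x, 0 <= phi x)%R ->
  \int[P]_t (phi (sign_flip e (X t)))%:E = \int[P]_t (phi (X t))%:E.
Proof.
move=> mphi phi0.
have mE : measurable_fun setT (EFin \o phi) by exact/measurable_EFinP.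
have phiE0 y : 0 <= (EFin \o phi) y by rewrite lee_fin.
rewrite -[RHS](@ge0_integral_distribution _ _ _ _ _ _ X (EFin \o phi))//.
have mflip := @measurable_sign_flip R n e.
have mEf : measurable_fun setT (EFin \o phi \o sign_flip e).
  exact: measurableT_comp.
rewrite -[LHS](@ge0_integral_distribution _ _ _ _ _ _ X (EFin \o phi \o sign_flip e))//; last first.
  by move=> y; rewrite /= lee_fin.
pose mixin := isMeasurableFun.Build _ _ _ _ _ mflip.
pose F : {mfun _ >-> _} := HB.pack (@sign_flip R n e) mixin.
rewrite -[LHS](@ge0_integral_pushforward _ _ _ _ _ _ mflip (distribution P X) setT (EFin \o phi))//.
apply: (eq_measure_integral (distribution P X)) => A mA _.
exact: uncX.
Qed.

(** The only sign vector moving [x] into the open orthant is the one that is minus exactly on the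
    negative coordinates. *)
Let sum_orthants (x : n.-tuple R) : (forall i, tnth x i != 0)%R ->
  (\sum_(e : {ffun 'I_n -> bool}) (\1_pos (sign_flip e x) : R) = 1)%R.
Proof.
move=> xn; pose e0 : {ffun 'I_n -> bool} := [ffun i => (tnth x i < 0)%R].
rewrite (bigD1 e0)//= big1 ?addr0.
  rewrite indicE mem_set// => i; rewrite sign_flip_tnth ffunE.
  have := xn i; rewrite neq_lt => /orP[x0|x0].
    by rewrite x0 expr1 mulN1r oppr_gt0.
  by rewrite [(tnth x i < 0)%R]ltNge (ltW x0) expr0 mul1r.
move=> e ee0; rewrite indicE memNset//= => epos; move/negP : ee0; apply.
apply/eqP/ffunP => i; rewrite ffunE; have := epos i; rewrite sign_flip_tnth.
case: (e i); rewrite /= ?expr0 ?expr1 ?mulN1r ?mul1r ?oppr_gt0 => //.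
by move=> /ltW; rewrite leNgt => /negbTE.
Qed.

(** Almost surely the indicators of the [2 ^+ n] reflected orthants sum to 1, and by
    unconditionality each of them contributes the same integral. *)
Lemma expectation_orthant (phi : n.-tuple R -> R) : measurable_fun setT phi ->
  (forall x, 0 <= phi x)%R -> (forall (e : {ffun 'I_n -> bool}) x, phi (sign_flip e x) = phi x) ->
  \int[P]_t (phi (X t))%:E =
  (2 ^+ n)%:E * \int[leb]_x (phi x * \1_pos x * w x)%:E.
Proof.
move=> mphi phi0 ephi; pose psi x : R := (phi x * \1_pos x)%R.
have mpos : measurable_fun setT (\1_pos : n.-tuple R -> R).
  by apply: measurable_indic; exact: measurable_tuple_pos.
have mpsi : measurable_fun setT psi by exact: measurable_funM.
have psi0 x : (0 <= psi x)%R by rewrite mulr_ge0.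
rewrite -(expectation_density mpsi)//.
transitivity (\int[P]_t \sum_(e : {ffun 'I_n -> bool}) (psi (sign_flip e (X t)))%:E).
  rewrite -[LHS](@ge0_integral_distribution _ _ _ _ _ _ X (EFin \o phi))//; last first.
    exact/measurable_EFinP.
  have mpe (e : {ffun 'I_n -> bool}) :
      measurable_fun setT (fun x => (psi (sign_flip e x))%:E).
    apply/measurable_EFinP; apply: measurableT_comp => //; exact: measurable_sign_flip.
  pose Psi (x : n.-tuple R) := \sum_(e : {ffun 'I_n -> bool}) (psi (sign_flip e x))%:E.
  have mPsi : measurable_fun setT Psi by exact: emeasurable_sum.
  rewrite -[RHS](@ge0_integral_distribution _ _ _ _ _ _ X Psi)//; last first.
    by move=> x; apply: sume_ge0 => e _; rewrite lee_fin.
  apply: ae_eq_integral => //; first exact/measurable_EFinP.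
  (* The coordinates are indexed by all naturals, with default value 1 beyond [n], so that a
     countable intersection of full sets can be used; the default is nonzero, hence harmless. *)
  have : almost_everywhere (distribution P X)
      (fun x : n.-tuple R => forall j : nat, nth 1%R x j != 0%R).
    apply: ae_foralln => j; have [kn|nk] := ltnP j n; last first.
      by apply: aeW => x; rewrite nth_default ?size_tuple// oner_neq0.
    exists [set x | tnth x (Ordinal kn) = 0%R]; split.
    - rewrite -[X in measurable X]setTI.
      exact: (@measurable_tnth _ R n (Ordinal kn) measurableT [set 0%R]).
    - exact: distribution_coordinate0.
    - by move=> x /=; rewrite (tnth_nth 1%R) => /negP; rewrite negbK => /eqP.
  apply: filterS => x xn _; rewrite /Psi /= sumEFin; congr EFin.
  rewrite (eq_bigr (fun e : {ffun 'I_n -> bool} => phi x * \1_pos (sign_flip e x))%R).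
    by rewrite -mulr_sumr sum_orthants ?mulr1// => i; rewrite (tnth_nth 1%R).
  by move=> e _; rewrite /psi ephi.
rewrite ge0_integral_sum//.
  rewrite (eq_bigr (fun=> \int[P]_t (psi (X t))%:E)) => [|e _]; last first.
    exact: expectation_sign_flip.
  rewrite sumr_const card_ffun card_bool card_ord ge0_mulrn_ereal ?natrX//.
  by apply: integral_ge0 => t _; rewrite lee_fin.
  move=> e; apply/measurable_EFinP; apply: measurableT_comp => //.
  by apply: measurableT_comp => //; exact: measurable_sign_flip.
by move=> e t _; rewrite lee_fin.
Qed.

(** This stands in for conditioning on the absolute values of the coordinates: averaging over all
    signs leaves the expectation unchanged. *)
Lemma expectation_avg_sign_flip (phi : n.-tuple R -> R) :
  measurable_fun setT phi -> (forall x, 0 <= phi x)%R ->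
  \int[P]_t (avg (fun e : {ffun 'I_n -> bool} => phi (sign_flip e (X t))))%:E =
  \int[P]_t (phi (X t))%:E.
Proof.
move=> mphi phi0.
have me (e : {ffun 'I_n -> bool}) : measurable_fun setT (fun t => (phi (sign_flip e (X t)))%:E).
  apply/measurable_EFinP; apply: measurableT_comp => //.
  by apply: measurableT_comp => //; exact: measurable_sign_flip.
have n2 : (0 < (2 ^+ n)^-1 :> R)%R by rewrite invr_gt0 exprn_gt0.
transitivity (\int[P]_t ((2 ^+ n)^-1%:E *
    \sum_(e : {ffun 'I_n -> bool}) (phi (sign_flip e (X t)))%:E)).
  by apply: eq_integral => t _; rewrite sumEFin -EFinM mulrC.
rewrite ge0_integralZl_EFin ?(ltW n2)//; last 2 first.
- by move=> t _; apply: sume_ge0 => e _; rewrite lee_fin.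
- exact: emeasurable_sum.
rewrite ge0_integral_sum//; last by move=> e t _; rewrite lee_fin.
rewrite (eq_bigr (fun=> \int[P]_t (phi (X t))%:E)) => [|e _]; last first.
  exact: expectation_sign_flip.
rewrite sumr_const card_ffun card_bool card_ord ge0_mulrn_ereal; last first.
  by apply: integral_ge0 => t _; rewrite lee_fin.
by rewrite natrX muleA -EFinM mulVf ?mul1e// expf_neq0.
Qed.

Variables (k : R) (u : n.-tuple R -> \bar R) (N : set (n.-tuple R)).
Hypotheses (k1 : (1 < k)%R) (uNy : forall x, u x <> -oo).
Hypothesis cvxu : econvex_on orthant (fun x => u (coord_pow k x)).
Hypotheses (mN : measurable N) (lebN : leb N = 0).
Hypothesis wN : forall x, N x -> w x = 0%R.
Hypothesis wu : forall x, ~ N x -> (w x)%:E = expeR (- u x).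

Lemma expectation_prekopa_leindler (f g h : n.-tuple R -> R) :
  measurable_fun setT f -> measurable_fun setT g -> measurable_fun setT h ->
  (forall x, 0 <= f x)%R -> (forall x, 0 <= g x)%R -> (forall x, 0 <= h x)%R ->
  (forall (e : {ffun 'I_n -> bool}) x, f (sign_flip e x) = f x) ->
  (forall (e : {ffun 'I_n -> bool}) x, g (sign_flip e x) = g x) ->
  (forall (e : {ffun 'I_n -> bool}) x, h (sign_flip e x) = h x) ->
  (forall x y, tuple_pos x -> tuple_pos y ->
    (tuple_pow_weight k x y * (f x * g y) <=
    h (tuple_pow_mean k x y) * h (tuple_pow_mean k x y)))%R ->
  \int[P]_t (f (X t))%:E * \int[P]_t (g (X t))%:E <=
  \int[P]_t (h (X t))%:E * \int[P]_t (h (X t))%:E.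
Proof.
move=> mf mg mh f0 g0 h0 ef eg eh fgh.
have mpos : measurable_fun setT (\1_pos : n.-tuple R -> R).
  by apply: measurable_indic; exact: measurable_tuple_pos.
have mF (phi : n.-tuple R -> R) : measurable_fun setT phi ->
    measurable_fun setT (fun x => (phi x * \1_pos x * w x)%:E).
  by move=> mphi; apply/measurable_EFinP; do 2 apply: measurable_funM => //.
have F0 (phi : n.-tuple R -> R) x : (forall x, 0 <= phi x)%R -> 0 <= (phi x * \1_pos x * w x)%:E.
  by move=> phi0; rewrite lee_fin !mulr_ge0.
rewrite !expectation_orthant// muleACA [leRHS]muleACA -EFinM.
rewrite lee_pmul2l// ?lte_fin ?mulr_gt0 ?exprn_gt0//.
have mNi : measurable_fun setT (fun x => +oo * (\1_N x : R)%:E).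
  by apply: measurable_funeM; apply/measurable_EFinP/measurable_indic.
(* The value [+oo] on the null set [N] leaves the integral unchanged, yet makes the inequality
   trivial when the mean of two points outside [N] falls into it. If [x] or [y] is in [N], the
   left-hand side vanishes through [w]. *)
pose H x := +oo * (\1_N x : R)%:E + (h x * \1_pos x * w x)%:E.
have N0 x : 0 <= +oo * (\1_N x : R)%:E by rewrite mule_ge0.
have -> : \int[leb]_x (h x * \1_pos x * w x)%:E = \int[leb]_x H x.
  rewrite ge0_integralD//; last 2 first.
  - by move=> x _; exact: F0.
  - exact: mF.
  rewrite ge0_integralZl//; last by apply/measurable_EFinP/measurable_indic.
  by rewrite integral_indic// setIT [X in _ * X]lebN mule0 add0e.
apply: (power_prekopa_leindler k1).
- exact: mF.
- exact: mF.
- by apply: emeasurable_funD => //; exact: mF.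
- by move=> x; exact: F0.
- by move=> x; exact: F0.
- by move=> x; rewrite adde_ge0// F0.
- by move=> x xp; rewrite indicE memNset// mulr0 mul0r.
- by move=> x xp; rewrite indicE memNset// mulr0 mul0r.
move=> x y x0 y0; set z := tuple_pow_mean k x y.
have z0 : tuple_pos z by move=> i; rewrite tnth_mktuple pow_mean_gt0.
have zN0 : 0 <= H z by rewrite adde_ge0// F0.
have [Nx|Nx] := pselect (N x); first by rewrite (wN Nx) mulr0 mul0e mule0 mule_ge0.
have [Ny|Ny] := pselect (N y); first by rewrite (wN Ny) mulr0 !mule0 mule_ge0.
rewrite !indicE !mem_set// !mulr1.
have [Nz|Nz] := pselect (N z).
  have -> : H z = +oo.
    by rewrite /H indicE mem_set// mule1 addye// (gt_eqF (lt_le_trans (ltNy0 _) (F0 _ _ h0))).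
  by rewrite mulyy leey.
have -> : H z = (h z * w z)%:E.
  by rewrite /H !indicE memNset// mem_set// mule0 add0e mulr1.
rewrite -!EFinM lee_fin.
have ww : (w x * w y <= w z * w z)%R.
  by rewrite -lee_fin !EFinM !wu//; exact: econvex_density.
have -> : (tuple_pow_weight k x y * (f x * w x * (g y * w y)) =
  (tuple_pow_weight k x y * (f x * g y)) * (w x * w y))%R by ring.
have -> : (h z * w z * (h z * w z) = (h z * h z) * (w z * w z))%R by ring.
by rewrite ler_pM ?mulr_ge0 ?tuple_pow_weight_ge0 ?fgh.
Qed.

End unconditional_expectation.

(** * Moment bounds for unconditional isotropic vectors and the final estimate *)

Definition fourth_moment_cst {R : realType} (k : R) : R :=
  (2 `^ k) ^+ 2 * (2 `^ k) ^+ 2.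

(** [C] is the constant of the conditional estimate; the first summand comes from
    [expectation_cubic], the second from [expectation_gap]. *)
Definition berry_esseen_cst {R : realType} (k C : R) : R :=
  let B := wquart_cst k * fourth_moment_cst k in
  C * ((1 + fourth_moment_cst k) / 2 + (2 * B + B ^+ 2 / 2)).

Section unconditional_clt.
Context {R : realType} {n : nat} {d : measure_display} {T : measurableType d}.
Variables (P : probability T R) (X : {RV P >-> n.-tuple R}).
Variables (u : n.-tuple R -> \bar R) (k : R) (theta : n.-tuple R).
Hypotheses (k1 : 1 < k) (uNy : forall x, u x <> -oo%E).
Hypotheses (uncX : unconditional X) (isoX : isotropic X).
Hypothesis densX : has_density X (fun x => expeR (- u x)%E).
Hypothesis cvxu : econvex_on orthant (fun x => u (coord_pow k x)).
Hypothesis theta1 : unit_sphere theta.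
Local Open Scope ereal_scope.

Let expectation_PL (f g h : n.-tuple R -> R) :
  measurable_fun setT f -> measurable_fun setT g -> measurable_fun setT h ->
  (forall x, 0 <= f x)%R -> (forall x, 0 <= g x)%R -> (forall x, 0 <= h x)%R ->
  (forall (e : {ffun 'I_n -> bool}) x, f (sign_flip e x) = f x) ->
  (forall (e : {ffun 'I_n -> bool}) x, g (sign_flip e x) = g x) ->
  (forall (e : {ffun 'I_n -> bool}) x, h (sign_flip e x) = h x) ->
  (forall x y, tuple_pos x -> tuple_pos y ->
    (tuple_pow_weight k x y * (f x * g y) <=
    h (tuple_pow_mean k x y) * h (tuple_pow_mean k x y)))%R ->
  \int[P]_t (f (X t))%:E * \int[P]_t (g (X t))%:E <=
  \int[P]_t (h (X t))%:E * \int[P]_t (h (X t))%:E.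
Proof.
have [w [N [[mN N0 mw w0] [wN wu wP]]]] := has_density_borel uNy densX.
exact: (expectation_prekopa_leindler mw w0 wP uncX k1 uNy cvxu mN N0 wN wu).
Qed.

Let measurable_coord i : measurable_fun setT (fun x : n.-tuple R => tnth x i).
Proof. exact: (@measurable_tnth _ R n i). Qed.

Let measurable_X i : measurable_fun setT (fun t => tnth (X t) i).
Proof. exact: (measurableT_comp (measurable_coord i)). Qed.

Let sum_theta_sqr : (\sum_i tnth theta i ^+ 2 = 1)%R.
Proof.
have := theta1; rewrite /unit_sphere/= /dot => h.
have d0 : (0 <= \sum_(i < n) tnth theta i * tnth theta i)%R.
  by apply: sumr_ge0 => i _; rewrite -expr2 sqr_ge0.
rewrite -(expr1n _ 2) -h sqr_sqrtr//; exact: eq_bigr.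
Qed.

Let moment2 i : \int[P]_t (tnth (X t) i ^+ 2)%:E = 1.
Proof.
by have := isoX.2 i i; rewrite eqxx unlock.
Qed.

Let integral_P_cst (c : R) : \int[P]_t c%:E = c%:E.
Proof. by rewrite integral_cst//= probability_setT mule1. Qed.

Notation m4 := (fourth_moment_cst k).

Let m4_ge0 : (0 <= m4)%R. Proof. by rewrite mulr_ge0 ?sqr_ge0. Qed.

Let moment4 i : \int[P]_t (tnth (X t) i ^+ 4)%:E <= m4%:E.
Proof.
have flip2 (e : {ffun 'I_n -> bool}) (x : n.-tuple R) :
    (tnth (sign_flip e x) i ^+ 2 = tnth x i ^+ 2)%R.
  by rewrite sign_flip_tnth exprMn sqrr_sign mul1r.
have := @expectation_PL (fun x => tnth x i ^+ 4)%R (fun=> 1%R)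
  (fun x => (2 `^ k) ^+ 2 * tnth x i ^+ 2)%R.
rewrite integral_P_cst mule1.
have -> : \int[P]_t ((2 `^ k) ^+ 2 * tnth (X t) i ^+ 2)%:E = ((2 `^ k) ^+ 2)%:E.
  under eq_integral do rewrite EFinM.
  rewrite ge0_integralZl_EFin ?sqr_ge0//; last 2 first.
  - by move=> t _; rewrite lee_fin sqr_ge0.
  - by apply/measurable_EFinP/measurable_funX.
  by rewrite moment2 mule1.
rewrite -EFinM; apply.
- exact: measurable_funX.
- by [].
- by apply: measurable_funM => //; exact: measurable_funX.
- by move=> x; rewrite (exprM _ 2 2) sqr_ge0.
- by [].
- by move=> x; rewrite mulr_ge0 ?sqr_ge0.
- by move=> e x; rewrite !(exprM _ 2 2) flip2.
- by [].
- by move=> e x; rewrite flip2.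
- by move=> x y x0 y0; exact: tuple_pow_weight_quart.
Qed.

Let measurable_wsqr : measurable_fun setT (wsqr theta).
Proof. by apply: measurable_sum => i; apply/measurable_funX/measurable_funM. Qed.

Let measurable_wquart : measurable_fun setT (wquart theta).
Proof. by apply: measurable_sum => i; apply/measurable_funX/measurable_funM. Qed.

Let measurable_inv_wsqr :
  measurable_fun setT (fun x : n.-tuple R => (1 + wsqr theta x)^-1)%R.
Proof.
rewrite (_ : (fun _ => _) = (fun x => (1 + wsqr theta x) `^ (-1))%R); last first.
  by apply/funext => x; rewrite powR_inv1// addr_ge0// wsqr_ge0.
apply: (measurableT_comp (measurable_powR (-1))).
exact: measurable_funD.
Qed.

Let wsqr_flip (e : {ffun 'I_n -> bool}) x : wsqr theta (sign_flip e x) = wsqr theta x.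
Proof.
apply: eq_bigr => i _; rewrite sign_flip_tnth !exprMn sqrr_sign.
by rewrite mul1r.
Qed.

Let wquart_flip (e : {ffun 'I_n -> bool}) x : wquart theta (sign_flip e x) = wquart theta x.
Proof.
apply: eq_bigr => i _; rewrite !(exprM _ 2 2); congr (_ ^+ 2)%R.
by rewrite sign_flip_tnth !exprMn sqrr_sign mul1r.
Qed.

Let expectation_wsqr : \int[P]_t (wsqr theta (X t))%:E = 1.
Proof.
under eq_integral do rewrite /wsqr -sumEFin.
rewrite ge0_integral_sum//; last 2 first.
- by move=> i; apply/measurable_EFinP/measurable_funX/measurable_funM.
- by move=> i t _; rewrite lee_fin sqr_ge0.
rewrite -sum_theta_sqr -sumEFin; apply: eq_bigr => i _.
under eq_integral do rewrite exprMn EFinM.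
rewrite ge0_integralZl_EFin ?sqr_ge0//; last 2 first.
- by move=> t _; rewrite lee_fin sqr_ge0.
- by apply/measurable_EFinP/measurable_funX.
by rewrite moment2 mule1.
Qed.

Let s3 : R := (\sum_i `|tnth theta i| ^+ 3)%R.

Let s3_ge0 : (0 <= s3)%R.
Proof. by apply: sumr_ge0 => i _; rewrite exprn_ge0. Qed.

Let theta_le1 i : (`|tnth theta i| <= 1)%R.
Proof.
have h : (tnth theta i ^+ 2 <= 1)%R.
  rewrite -sum_theta_sqr (bigD1 i)//= lerDl sumr_ge0// => j _; exact: sqr_ge0.
by rewrite -(@expr_le1 _ 2)// real_normK ?num_real.
Qed.

(** Lets [expectation_gap] replace [s3 * s3] by [s3], keeping the final bound linear. *)
Let s3_le1 : (s3 <= 1)%R.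
Proof.
rewrite -sum_theta_sqr; apply: ler_sum => i _.
by rewrite -(real_normK (num_real (tnth theta i))) exprS ler_piMl// exprn_ge0.
Qed.

(** Fourth powers of the [theta i] are weakened to third powers, since [|theta i| <= 1], to match
    the order of the Berry-Esseen term. *)
Let expectation_wquart : \int[P]_t (wquart theta (X t))%:E <= (m4 * s3)%:E.
Proof.
under eq_integral do rewrite /wquart -sumEFin.
rewrite ge0_integral_sum//; last 2 first.
- by move=> i; apply/measurable_EFinP/measurable_funX/measurable_funM.
- by move=> i t _; rewrite lee_fin (exprM _ 2 2) sqr_ge0.
rewrite mulr_sumr -sumEFin; apply: lee_sum => i _.
have t4 : (tnth theta i ^+ 4 = `|tnth theta i| ^+ 4)%R.
  by rewrite !(exprM _ 2 2) real_normK ?num_real.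
under eq_integral do rewrite exprMn EFinM.
rewrite ge0_integralZl_EFin ?t4 ?exprn_ge0//; last 2 first.
- by move=> t _; rewrite lee_fin (exprM _ 2 2) sqr_ge0.
- by apply/measurable_EFinP/measurable_funX.
rewrite [(m4 * _)%R]mulrC [leRHS]EFinM; apply: lee_pmul => //.
- by apply: integral_ge0 => t _; rewrite lee_fin (exprM _ 2 2) sqr_ge0.
- by rewrite lee_fin exprS ler_piMl ?exprn_ge0.
Qed.

Notation B := (wquart_cst k * m4)%R.

Let B_ge0 : (0 <= B)%R.
Proof. by rewrite mulr_ge0// wquart_cst_ge0. Qed.

(* As [E (1 + Y) = 2], this bounds the gap in Jensen's inequality for [1 / (1 + Y)]. *)
Let expectation_inv_wsqr :
  2%:E * \int[P]_t ((1 + wsqr theta (X t))^-1)%:E <=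
  ((1 + B / 2 * s3) * (1 + B / 2 * s3))%:E.
Proof.
have B2 : (0 <= wquart_cst k / 2)%R by rewrite divr_ge0 ?wquart_cst_ge0.
have Y0 x := wsqr_ge0 theta x; have Q0 x := wquart_ge0 theta x.
have mB : measurable_fun setT (fun x => wquart_cst k / 2 * wquart theta x)%R.
  exact: measurable_funM.
have -> : 2%:E = \int[P]_t (1 + wsqr theta (X t))%:E.
  under eq_integral do rewrite EFinD.
  rewrite ge0_integralD//; last 2 first.
  - by move=> t _; rewrite lee_fin.
  - by apply/measurable_EFinP; exact: measurableT_comp.
  by rewrite integral_P_cst expectation_wsqr.
have hle : \int[P]_t (1 + wquart_cst k / 2 * wquart theta (X t))%:E <= (1 + B / 2 * s3)%:E.
  under eq_integral do rewrite EFinD EFinM.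
  rewrite ge0_integralD//; last 2 first.
  - by move=> t _; rewrite -EFinM lee_fin mulr_ge0.
  - by apply/measurable_funeM/measurable_EFinP; exact: measurableT_comp.
  rewrite ge0_integralZl_EFin//; last 2 first.
  - by move=> t _; rewrite lee_fin.
  - by apply/measurable_EFinP; exact: measurableT_comp.
  rewrite integral_P_cst EFinD leeD2l//.
  have -> : (B / 2 * s3 = wquart_cst k / 2 * (m4 * s3))%R by ring.
  by rewrite [leRHS]EFinM lee_wpmul2l.
apply: (@le_trans _ _ (\int[P]_t (1 + wquart_cst k / 2 * wquart theta (X t))%:E *
    \int[P]_t (1 + wquart_cst k / 2 * wquart theta (X t))%:E)); last first.
  have I0 : 0 <= \int[P]_t (1 + wquart_cst k / 2 * wquart theta (X t))%:E.
    by apply: integral_ge0 => t _; rewrite lee_fin addr_ge0// mulr_ge0.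
  by rewrite EFinM lee_pmul.
apply: (@expectation_PL (fun x => 1 + wsqr theta x)%R
  (fun x => (1 + wsqr theta x)^-1)%R
  (fun x => 1 + wquart_cst k / 2 * wquart theta x)%R).
- exact: measurable_funD.
- exact: measurable_inv_wsqr.
- exact: measurable_funD.
- by move=> x; rewrite addr_ge0.
- by move=> x; rewrite invr_ge0 addr_ge0.
- by move=> x; rewrite addr_ge0// mulr_ge0.
- by move=> e x; rewrite wsqr_flip.
- by move=> e x; rewrite wsqr_flip.
- by move=> e x; rewrite wquart_flip.
- by move=> x y x0 y0; exact: tuple_pow_weight_wsqr.
Qed.

Let gap (x : n.-tuple R) : R := ((wsqr theta x - 1) ^+ 2 / (1 + wsqr theta x))%R.

Let gap_ge0 x : (0 <= gap x)%R.
Proof. by rewrite divr_ge0 ?sqr_ge0 ?addr_ge0 ?wsqr_ge0. Qed.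

Let measurable_gap : measurable_fun setT gap.
Proof.
apply: measurable_funM; last exact: measurable_inv_wsqr.
by apply: measurable_funX; exact: measurable_funB.
Qed.

Let expectation_gap : \int[P]_t (gap (X t))%:E <= ((2 * B + B ^+ 2 / 2) * s3)%:E.
Proof.
have Y0 x := wsqr_ge0 theta x.
(* The identity [(Y - 1)^2 / (1 + Y) + 4 = (1 + Y) + 4 / (1 + Y)], arranged without subtraction so
   that every integrand is nonnegative. *)
have gapE : \int[P]_t (gap (X t))%:E + 4%:E =
    2%:E + 4%:E * \int[P]_t ((1 + wsqr theta (X t))^-1)%:E.
  transitivity (\int[P]_t ((gap (X t))%:E + 4%:E)).
    rewrite ge0_integralD ?integral_P_cst//.
    - by move=> t _; rewrite lee_fin.
    - by apply/measurable_EFinP; exact: measurableT_comp.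
  transitivity (\int[P]_t ((1 + wsqr theta (X t))%:E + (4 * (1 + wsqr theta (X t))^-1)%:E)).
    apply: eq_integral => t _; rewrite -!EFinD; congr EFin; rewrite /gap; field.
    by rewrite gt_eqF// ltr_pwDl.
  rewrite ge0_integralD//; last 4 first.
  - by move=> t _; rewrite lee_fin addr_ge0.
  - by apply/measurable_EFinP/measurable_funD => //; exact: measurableT_comp.
  - by move=> t _; rewrite lee_fin mulr_ge0// invr_ge0 addr_ge0.
  - by apply/measurable_EFinP/measurable_funM => //; exact: measurableT_comp measurable_inv_wsqr _.
  congr (_ + _).
    under eq_integral do rewrite EFinD.
    rewrite ge0_integralD//; last 2 first.
    - by move=> t _; rewrite lee_fin.
    - by apply/measurable_EFinP; exact: measurableT_comp.
    by rewrite integral_P_cst expectation_wsqr.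
  under eq_integral do rewrite EFinM.
  rewrite ge0_integralZl_EFin//.
  - by move=> t _; rewrite lee_fin invr_ge0 addr_ge0.
  - by apply/measurable_EFinP; exact: measurableT_comp measurable_inv_wsqr _.
rewrite -(@leeD2rE _ 4%:E)// gapE -EFinD.
have -> : 4%:E = 2%:E * 2%:E :> \bar R by rewrite -EFinM; congr EFin; ring.
rewrite -muleA; apply: (le_trans (leeD2l _ (lee_wpmul2l _ expectation_inv_wsqr))).
  by rewrite lee_fin.
rewrite -EFinM -EFinD lee_fin.
have : (B ^+ 2 * (s3 * s3) <= B ^+ 2 * s3)%R by rewrite ler_wpM2l ?sqr_ge0// ler_piMl.
by rewrite expr2; lra.
Qed.

(** A majorant of [sum |theta_i x_i|^3], from [2 * |x|^3 <= x^2 + x^4], so that second and fourth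
    moments suffice. *)
Let cubic (x : n.-tuple R) : R :=
  (\sum_i `|tnth theta i| ^+ 3 * ((tnth x i ^+ 2 + tnth x i ^+ 4) / 2))%R.

Let cubic_ge0 x : (0 <= cubic x)%R.
Proof.
apply: sumr_ge0 => i _; rewrite mulr_ge0 ?exprn_ge0// divr_ge0// addr_ge0 ?sqr_ge0//.
by rewrite (exprM _ 2 2) sqr_ge0.
Qed.

Let measurable_cubic : measurable_fun setT cubic.
Proof.
apply: measurable_sum => i; apply: measurable_funM => //; apply: measurable_funM => //.
by apply: measurable_funD; exact: measurable_funX.
Qed.

Let expectation_cubic : \int[P]_t (cubic (X t))%:E <= ((1 + m4) / 2 * s3)%:E.
Proof.
have p4 x i : (0 <= tnth x i ^+ 4 :> R)%R by rewrite (exprM _ 2 2) sqr_ge0.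
have mc i : measurable_fun setT (fun t => (tnth (X t) i ^+ 2 + tnth (X t) i ^+ 4) / 2)%R.
  by apply: measurable_funM => //; apply: measurable_funD; exact: measurable_funX.
under eq_integral do rewrite /cubic -sumEFin.
rewrite ge0_integral_sum//; last 2 first.
- by move=> i; apply/measurable_EFinP/measurable_funM.
- by move=> i t _; rewrite lee_fin mulr_ge0 ?exprn_ge0// divr_ge0// addr_ge0 ?sqr_ge0.
rewrite mulr_sumr -sumEFin; apply: lee_sum => i _.
under eq_integral do rewrite EFinM.
rewrite ge0_integralZl_EFin ?exprn_ge0//; last 2 first.
- by move=> t _; rewrite lee_fin divr_ge0// addr_ge0 ?sqr_ge0.
- exact/measurable_EFinP.
rewrite [(_ / 2 * _)%R]mulrC [leRHS]EFinM lee_wpmul2l ?lee_fin ?exprn_ge0//.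
under eq_integral do rewrite mulrC EFinM EFinD.
rewrite ge0_integralZl_EFin//; last 2 first.
- by move=> t _; rewrite -EFinD lee_fin addr_ge0 ?sqr_ge0.
- by apply: emeasurable_funD; apply/measurable_EFinP/measurable_funX.
rewrite mulrC EFinM lee_wpmul2l ?lee_fin//.
rewrite ge0_integralD//; last 4 first.
- by move=> t _; rewrite lee_fin sqr_ge0.
- by apply/measurable_EFinP/measurable_funX.
- by move=> t _; rewrite lee_fin.
- by apply/measurable_EFinP/measurable_funX.
by rewrite moment2 EFinD leeD2l.
Qed.

Let rsum_dot (e : {ffun 'I_n -> bool}) (x : n.-tuple R) :
  rsum (fun i => tnth theta i * tnth x i)%R e = dot theta (sign_flip e x).
Proof. by apply: eq_bigr => i _; rewrite sign_flip_tnth mulrCA. Qed.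

Lemma unconditional_berry_esseen (C t : R) : (0 <= C)%R ->
  (forall m (a : 'I_m -> R) s Y, Y = \sum_i a i ^+ 2 ->
   `|avg (fun e => (s <= rsum a e)%R%:R) - (1 - gcdf s) - s * normal_pdf 0 1 s / 2 * (Y - 1)|
   <= C * (\sum_i `|a i| ^+ 3 + (Y - 1) ^+ 2 / (1 + Y)))%R ->
  `|P [set w | (t <= dot theta (X w))%R] - (1 - gcdf t)%:E| <=
  (berry_esseen_cst k C * \sum_i `|tnth theta i| ^+ 3)%:E.
Proof.
move=> C0 approx; rewrite /berry_esseen_cst -/s3.
pose phi (x : n.-tuple R) : R := (t <= dot theta x)%R%:R.
have mS : measurable [set x : n.-tuple R | (t <= dot theta x)%R].
  rewrite -[X in measurable X]setTI; apply: measurable_fun_le => //.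
  by apply: measurable_sum => i; exact: measurable_funM.
have mSX : measurable [set w | (t <= dot theta (X w))%R] := measurable_funPTI X mS.
have phiE x : phi x = \1_[set x : n.-tuple R | (t <= dot theta x)%R] x.
  by rewrite /phi indicE mem_setE.
have mphi : measurable_fun setT phi.
  by rewrite (funext phiE); exact: measurable_indic.
pose A w : R := avg (fun e : {ffun 'I_n -> bool} => phi (sign_flip e (X w))).
pose c : R := (t * normal_pdf 0 1 t / 2)%R; pose g : R := (1 - gcdf t)%R.
have intA : \int[P]_w (A w)%:E = P [set w | (t <= dot theta (X w))%R].
  rewrite (expectation_avg_sign_flip uncX)//.
  rewrite -[X in P X]setIT -integral_indic//.
  by apply: eq_integral => w _; rewrite phiE.
have A0 w : (0 <= A w)%R.
  by rewrite -(avg_cst (n := n) (0 : R)); apply: avg_le => e.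
have mA : measurable_fun setT A.
  apply: measurable_funM => //; apply: measurable_sum => e.
  apply: (measurableT_comp mphi); apply: measurableT_comp => //.
  exact: measurable_sign_flip.
have iA : P.-integrable setT (EFin \o A).
  apply/integrableP; split; first exact/measurable_EFinP.
  under eq_integral do rewrite /= ger0_norm//.
  by rewrite intA; apply: (le_lt_trans (probability_le1 P mSX)); rewrite ltry.
have iY : P.-integrable setT (fun w => (wsqr theta (X w))%:E).
  apply/integrableP; split; first by apply/measurable_EFinP; exact: measurableT_comp.
  under eq_integral do rewrite /= ger0_norm ?wsqr_ge0//.
  by rewrite expectation_wsqr ltry.
have icst (r : R) : P.-integrable setT (fun=> r%:E).
  by apply: finite_measure_integrable_cst.
have icY : P.-integrable setT (fun w => c%:E * (wsqr theta (X w))%:E) by exact: integrableZl.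
(* Since [Y] has mean 1, the linear correction [c * (Y - 1)] integrates to zero; subtracting it
   leaves the difference of probabilities unchanged while the integrand becomes pointwise small. *)
have intL : \int[P]_w ((A w)%:E - ((g - c)%:E + c%:E * (wsqr theta (X w))%:E)) =
    P [set w | (t <= dot theta (X w))%R] - g%:E.
  rewrite integralB//; last exact: integrableD.
  rewrite intA integralD// integralZl// expectation_wsqr integral_P_cst mule1.
  by rewrite -EFinD subrK.
rewrite -/g -intL.
have mL : measurable_fun setT
    (fun w => (A w)%:E - ((g - c)%:E + c%:E * (wsqr theta (X w))%:E)).
  apply: emeasurable_funB; first exact/measurable_EFinP.
  by apply: emeasurable_funD => //; apply: measurable_int icY.
apply: (le_trans (le_abse_integral _ measurableT mL)).
apply: (@le_trans _ _ (\int[P]_w (C * (cubic (X w) + gap (X w)))%:E)).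
  apply: ge0_le_integral => //.
  - exact: measurableT_comp.
  - apply/measurable_EFinP/measurable_funM => //.
    by apply: measurable_funD; exact: measurableT_comp.
  move=> w _; rewrite -EFinM -!EFinD /= lee_fin.
  have YE : wsqr theta (X w) = (\sum_i (tnth theta i * tnth (X w) i) ^+ 2)%R by [].
  have -> : (A w - (g - c + c * wsqr theta (X w)) =
      avg (fun e => (t <= rsum (fun i => tnth theta i * tnth (X w) i) e)%R%:R) -
      (1 - gcdf t) - c * (wsqr theta (X w) - 1))%R.
    rewrite /A (eq_avg (G := fun e => (t <= rsum (fun i => tnth theta i * tnth (X w) i) e)%R%:R)%R).
      by rewrite /g; ring.
    by move=> e; rewrite rsum_dot.
  apply: (le_trans (approx n _ t _ YE)); rewrite ler_wpM2l// lerD2r.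
  apply: ler_sum => i _; rewrite normrM exprMn ler_wpM2l ?exprn_ge0//.
  have n2 := real_normK (num_real (tnth (X w) i)).
  rewrite ler_pdivlMr// (exprM _ 2 2) -n2 -exprM.
  have := mulr_ge0 (sqr_ge0 `|tnth (X w) i|) (sqr_ge0 (`|tnth (X w) i| - 1)).
  by lra.
under eq_integral do rewrite EFinM EFinD.
rewrite ge0_integralZl_EFin//; last 2 first.
- by move=> w _; rewrite -EFinD lee_fin addr_ge0.
- by apply: emeasurable_funD; apply/measurable_EFinP; exact: measurableT_comp.
rewrite -mulrA EFinM lee_wpmul2l ?lee_fin// mulrDl EFinD.
rewrite ge0_integralD//; last 4 first.
- by move=> w _; rewrite lee_fin.
- by apply/measurable_EFinP; exact: measurableT_comp.
- by move=> w _; rewrite lee_fin.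
- by apply/measurable_EFinP; exact: measurableT_comp.
exact: leeD.
Qed.

End unconditional_clt.

Unset Implicit Arguments.

Theorem theorem1p1 (R : realType) (kappa : R) (hkappa : 1 < kappa) :
  exists C : R, 0 < C /\
    forall (n : nat) (hn : (1 <= n)%N)
      (d : measure_display) (T : measurableType d) (P : probability T R)
      (X : {RV P >-> n.-tuple R}) (u : n.-tuple R -> \bar R)
      (d' : measure_display) (T' : measurableType d') (Q : probability T' R)
      (G : {RV Q >-> R}) (theta : n.-tuple R) (t : R),
    unconditional X ->
    isotropic X ->
    (forall x, u x <> -oo%E) ->
    has_density X (fun x => expeR (- u x)%E) ->
    econvex_on orthant (fun x => u (coord_pow kappa x)) ->
    standard_gaussian G ->
    unit_sphere theta ->
    (`| P [set w | (t <= dot theta (X w))%R] - Q [set w | (t <= G w)%R] |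
       <= (C * \sum_(k < n) `|tnth theta k| ^+ 3)%:E)%E.
Proof.
have [C0 C0_ge0 approx] := @rsum_gaussian_approx R.
have K0 : 0 <= berry_esseen_cst kappa C0.
  have m0 : 0 <= fourth_moment_cst kappa by rewrite mulr_ge0 ?sqr_ge0.
  have B0 := mulr_ge0 (wquart_cst_ge0 hkappa) m0.
  apply: mulr_ge0 => //; apply: addr_ge0; first by rewrite divr_ge0// addr_ge0.
  by apply: addr_ge0; [exact: mulr_ge0|rewrite divr_ge0// sqr_ge0].
(* The added 1 turns a nonnegative constant into a positive one. *)
exists (berry_esseen_cst kappa C0 + 1); split; first by rewrite ltr_wpDl.
move=> n _ d T P X u d' T' Q G theta t uncX isoX uNy densX cvxu gaussG theta1.
have -> : Q [set w | (t <= G w)%R] = (1 - gcdf t)%:E.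
  rewrite -normal_prob_itv -gaussG; last exact: measurable_itv.
  by congr (Q _); apply/seteqP; split => w /=; rewrite in_itv/= andbT.
apply: (le_trans (unconditional_berry_esseen hkappa uNy uncX isoX densX cvxu theta1 t
  C0_ge0 approx)).
by rewrite lee_fin ler_wpM2r ?lerDl// sumr_ge0// => i _; rewrite exprn_ge0.
Qed.
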